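(* The Algorithmic Equaliser Problem is soluble for immersions of free groups. That is, there exists an algorithm which, given finite alphabets $\Sigma,\Delta$ and two immersions $g,h:F(\Sigma)\to F(\Delta)$, outputs (a) a finite basis for the subgroup $\operatorname{Eq}(g,h)$ of $F(\Sigma)$, and also an algorithm which on the same input outputs (b) a finite automaton recognising the set $\operatorname{Eq}(g,h)$.
   Context: $F(\Sigma)$ is the free group on $\Sigma$, viewed as the set of freely reduced words over $\Sigma\cup\Sigma^{-1}$. A group morphism $f:F(\Sigma)\to F(\Delta)$ is an immersion if for every $x\in\Sigma\cup\Sigma^{-1}$ the freely reduced word $f(x)$ is non-empty and, for distinct $x,y\in\Sigma\cup\Sigma^{-1}$, the freely reduced words $f(x)$ and $f(y)$ start with different letters of $\Delta\cup\Delta^{-1}$. For morphisms $g,h:F(\Sigma)\to F(\Delta)$, $\operatorname{Eq}(g,h)=\{x\in F(\Sigma)\mid g(x)=h(x)\}$. A morphism $f:F(\Sigma)\to F(\Delta)$ is given as the list of reduced words $(f(a))_{a\in\Sigma}$. The Algorithmic Equaliser Problem consists of the two parts (a) and (b) of the claim; a part is insoluble if the required finite object does not exist. In (b), $\operatorname{Eq}(g,h)$ is regarded as a set of freely reduced words over $\Sigma\cup\Sigma^{-1}$. *)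

(* Defs.v *)
From HB Require Import structures.
From mathcomp Require Import all_boot.
Set Implicit Arguments.
Unset Strict Implicit.
Unset Printing Implicit Defensive.

Local Open Scope group_scope.

(* (a, false) stands for the letter a and (a, true) for a^-1. *)
Definition letter (A : Type) : Type := (A * bool)%type.

Definition linv (A : Type) (x : letter A) : letter A := (x.1, ~~ x.2).

Lemma linvK (A : Type) : involutive (@linv A).
Proof. by case=> a b; rewrite /linv /= negbK. Qed.

Section Reduction.
Variable A : eqType.
Implicit Types (x y : letter A) (u v w : seq (letter A)).

Definition reduced w : bool := sorted (fun x y => y != linv x) w.

Definition lcons x w : seq (letter A) :=
  if w is y :: w' then if y == linv x then w' else x :: w else [:: x].

Definition reduce w : seq (letter A) := foldr lcons [::] w.

Lemma reduced_behead x w : reduced (x :: w) -> reduced w.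
Proof. by case: w => //= y w /andP[]. Qed.

Lemma reduced_lcons x w : reduced w -> reduced (lcons x w).
Proof.
case: w => [|y w] // rw; rewrite /lcons; case: ifPn => [_|nyx].
  exact: reduced_behead rw.
by rewrite /reduced /= nyx.
Qed.

Lemma reduced_foldr u w : reduced w -> reduced (foldr lcons w u).
Proof. by move=> rw; elim: u => //= x u; apply: reduced_lcons. Qed.

Lemma reduced_reduce w : reduced (reduce w).
Proof. exact: reduced_foldr. Qed.

Lemma reduce_id w : reduced w -> reduce w = w.
Proof.
elim: w => //= x w IHw rw; have rw' := reduced_behead rw.
rewrite /= -/(reduce w) IHw //; case: w rw {IHw rw'} => //= y w.
by case/andP=> /negPf->.
Qed.

Lemma lconsK x w : reduced w -> lcons (linv x) (lcons x w) = w.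
Proof.
case: w => [|y w] rw /=; first by rewrite linvK eqxx.
case: eqP => [yE|_]; last by rewrite /= linvK eqxx.
case: w rw => [|z w] /=; first by rewrite yE.
by case/andP=> nz _; rewrite -yE (negPf nz).
Qed.

Lemma foldr_lcons x u w :
  reduced w -> foldr lcons w (lcons x u) = lcons x (foldr lcons w u).
Proof.
move=> rw; case: u => //= y u; case: eqP => //= ->.
by have := lconsK (linv x) (reduced_foldr u rw); rewrite linvK => ->.
Qed.

Lemma foldr_reduce u w : reduced w -> foldr lcons w (reduce u) = foldr lcons w u.
Proof. by move=> rw; elim: u => //= x u IHu; rewrite foldr_lcons // IHu. Qed.

Lemma reduce_catl u w : reduce (reduce u ++ w) = reduce (u ++ w).
Proof. by rewrite /reduce !foldr_cat foldr_reduce // reduced_reduce. Qed.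

Lemma reduce_catr u w : reduce (u ++ reduce w) = reduce (u ++ w).
Proof.
by rewrite /reduce !foldr_cat -/(reduce _) reduce_id // reduced_reduce.
Qed.

Definition winv w : seq (letter A) := rev [seq linv x | x <- w].

Lemma reduced_winv w : reduced w -> reduced (winv w).
Proof.
rewrite /winv /reduced rev_sorted sorted_map; apply: sub_sorted => x y.
by rewrite /= (can_eq (@linvK A)) -(inj_eq (can_inj (@linvK A))) linvK eq_sym.
Qed.

Lemma reduce_winv_cat u w : reduced w -> reduce (winv u ++ (u ++ w)) = w.
Proof.
move=> rw; elim: u w rw => [|x u IHu] w rw; first by rewrite reduce_id.
rewrite /winv /= rev_cons -cats1 -catA -/(winv u).
rewrite -reduce_catr.
have -> : reduce ([:: linv x] ++ x :: u ++ w) = reduce (u ++ w).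
  by rewrite /reduce /= lconsK // reduced_foldr.
by rewrite reduce_catr IHu.
Qed.

End Reduction.

Section FreeGroup.
Variable A : choiceType.

Record freeGroup := FreeGroup {
  word : seq (letter A);
  word_reduced : reduced word
}.

HB.instance Definition _ := [isSub for word].
HB.instance Definition _ := [Choice of freeGroup by <:].

Definition fg_one : freeGroup := @FreeGroup [::] isT.
Definition fg_mul (x y : freeGroup) : freeGroup :=
  FreeGroup (reduced_reduce (word x ++ word y)).
Definition fg_inv (x : freeGroup) : freeGroup :=
  FreeGroup (reduced_winv (word_reduced x)).

Lemma fg_mulA : associative fg_mul.
Proof.
by move=> x y z; apply: val_inj; rewrite /= reduce_catl reduce_catr catA.
Qed.

Lemma fg_mul1x : left_id fg_one fg_mul.
Proof. by move=> x; apply: val_inj; rewrite /= reduce_id // word_reduced. Qed.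

Lemma fg_mulx1 : right_id fg_one fg_mul.
Proof.
by move=> x; apply: val_inj; rewrite /= cats0 reduce_id // word_reduced.
Qed.

Lemma fg_mulVx : left_inverse fg_one fg_inv fg_mul.
Proof.
by move=> x; apply: val_inj; rewrite /= -{2}[word x]cats0 reduce_winv_cat.
Qed.

Lemma fg_mulxV : right_inverse fg_one fg_inv fg_mul.
Proof.
move=> x; rewrite -{1}[x](_ : fg_inv (fg_inv x) = x) ?fg_mulVx //.
apply: val_inj; rewrite /= /winv map_rev revK -map_comp.
by rewrite (eq_map (@linvK A)) map_id.
Qed.

HB.instance Definition _ :=
  isGroup.Build freeGroup fg_mulA fg_mul1x fg_mulx1 fg_mulVx fg_mulxV.

Definition of_letter (x : letter A) : freeGroup := @FreeGroup [:: x] isT.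

End FreeGroup.

(* The morphism freeGroup I -> G extending b : I -> G. *)
Section Lift.
Variables (I : choiceType) (G : groupType) (b : I -> G).

Definition letter_val (x : letter I) : G := if x.2 then (b x.1)^-1 else b x.1.

Definition lift_fun (x : freeGroup I) : G :=
  \prod_(l <- word x) letter_val l.

Lemma prod_reduce (w : seq (letter I)) :
  \prod_(l <- reduce w) letter_val l = \prod_(l <- w) letter_val l.
Proof.
have valV x : letter_val x * letter_val (linv x) = 1.
  by case: x => a [] /=; rewrite /letter_val /= ?mulVg ?mulgV.
elim: w => //= x w IHw; rewrite big_cons -IHw -/(reduce w).
case: (reduce w) => [|y v] /=; first by rewrite big_cons.
by case: eqP => [->|_]; rewrite !big_cons // mulgA valV mul1g.
Qed.

Lemma lift_funM : {morph lift_fun : x y / x * y}.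
Proof. by move=> x y; rewrite /lift_fun prod_reduce big_cat. Qed.

HB.instance Definition _ :=
  isMultiplicative.Build (freeGroup I) G lift_fun lift_funM.

End Lift.

(* The members of the list B freely generate H: the morphism from the free
   group on the positions of B is a bijection onto H. *)
Definition is_basis (G : groupType) (B : seq G) (H : {pred G}) : Prop :=
  injective (lift_fun (tnth (in_tuple B))) /\
  (forall x, x \in H <-> exists y, lift_fun (tnth (in_tuple B)) y = x).

Definition equaliser (G H : groupType) (g h : G -> H) : {pred G} :=
  [pred x | g x == h x].

Definition immersion (A B : choiceType) (f : freeGroup A -> freeGroup B) : Prop :=
  (forall x : letter A, word (f (of_letter x)) <> [::]) /\
  (forall x y : letter A, x <> y ->
     ohead (word (f (of_letter x))) <> ohead (word (f (of_letter y)))).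

Record dfa (L : Type) := DFA {
  dfa_size : nat;
  dfa_init : 'I_dfa_size;
  dfa_final : pred 'I_dfa_size;
  dfa_step : 'I_dfa_size -> L -> 'I_dfa_size
}.

Definition dfa_accepts (L : Type) (M : dfa L) (w : seq L) : bool :=
  dfa_final (foldl (@dfa_step L M) (dfa_init M) w).

Definition recognises (L : Type) (M : dfa L) (S : seq L -> Prop) : Prop :=
  forall w, dfa_accepts M w <-> S w.

Definition words_of (A : choiceType) (H : {pred freeGroup A})
    (w : seq (letter A)) : Prop :=
  exists2 x, x \in H & word x = w.

(* The model of computation is Jones's WHILE language over binary trees, in
   its one-variable form (N. D. Jones, "Computability and Complexity from a
   Programming Perspective"), which is Turing-complete; [If] is only sugar.
   The single variable holds the input at the start and the output at the
   end; Leaf is the false value. *)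

Inductive tree := Leaf | Node of tree & tree.

Inductive expr :=
  | EVar
  | ENil
  | ECons of expr & expr
  | EHd of expr
  | ETl of expr.

Inductive cmd :=
  | Assign of expr
  | Seq of cmd & cmd
  | If of expr & cmd & cmd
  | While of expr & cmd.

Definition hd (t : tree) : tree := if t is Node t1 _ then t1 else Leaf.
Definition tl (t : tree) : tree := if t is Node _ t2 then t2 else Leaf.

Fixpoint eval (e : expr) (s : tree) : tree :=
  match e with
  | EVar => s
  | ENil => Leaf
  | ECons e1 e2 => Node (eval e1 s) (eval e2 s)
  | EHd e1 => hd (eval e1 s)
  | ETl e1 => tl (eval e1 s)
  end.

Definition truthy (t : tree) : bool := if t is Leaf then false else true.

Inductive exec : cmd -> tree -> tree -> Prop :=
  | ExecAssign e s : exec (Assign e) s (eval e s)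
  | ExecSeq c1 c2 s1 s2 s3 :
      exec c1 s1 s2 -> exec c2 s2 s3 -> exec (Seq c1 c2) s1 s3
  | ExecIf e c1 c2 s s' :
      exec (if truthy (eval e s) then c1 else c2) s s' -> exec (If e c1 c2) s s'
  | ExecWhileEnd e c s :
      ~~ truthy (eval e s) -> exec (While e c) s s
  | ExecWhileStep e c s1 s2 s3 :
      truthy (eval e s1) -> exec c s1 s2 -> exec (While e c) s2 s3 ->
      exec (While e c) s1 s3.

Definition enc_list (T : Type) (enc : T -> tree) (s : seq T) : tree :=
  foldr (fun x t => Node (enc x) t) Leaf s.

Definition enc_nat (n : nat) : tree := iter n (Node Leaf) Leaf.

Definition enc_bool (b : bool) : tree := if b then Node Leaf Leaf else Leaf.

Section Encoding.
Variable A : finType.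

(* A finite alphabet is presented by its cardinality, and a letter by its
   position in the enumeration of the alphabet. *)
Definition enc_alphabet : tree := enc_nat #|A|.

Definition enc_letter (x : letter A) : tree :=
  Node (enc_nat (enum_rank x.1)) (enc_bool x.2).

Definition enc_element (x : freeGroup A) : tree := enc_list enc_letter (word x).

Definition enc_basis (B : seq (freeGroup A)) : tree := enc_list enc_element B.

Definition enc_dfa (M : dfa (letter A)) : tree :=
  let st (q : 'I_(dfa_size M)) := enc_nat q in
  let row q :=
    enc_list (fun a => Node (st (dfa_step q (a, false)))
                            (st (dfa_step q (a, true)))) (enum A) in
  Node (st (dfa_init M))
    (enc_list (fun q => Node (enc_bool (dfa_final q)) (row q))
       (enum 'I_(dfa_size M))).

End Encoding.

Definition enc_morphism (A B : finType) (f : freeGroup A -> freeGroup B) : tree :=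
  enc_list (fun a => enc_element (f (of_letter (a, false)))) (enum A).

Definition enc_instance (A B : finType) (g h : freeGroup A -> freeGroup B) : tree :=
  Node (enc_alphabet A)
    (Node (enc_alphabet B) (Node (enc_morphism g) (enc_morphism h))).

(* Main.v *)
Require Import Defs.
From mathcomp Require Import all_boot.
From mathcomp Require Import zify.
From Stdlib Require Import ClassicalEpsilon FunctionalExtensionality.
Set Implicit Arguments.
Unset Strict Implicit.
Unset Printing Implicit Defensive.

(** An immersion acts on reduced words letter by letter: the images of
    consecutive letters do not cancel ([reduced_extend], [word_image]).  So the
    words of Eq(g,h) are the reduced words w such that g(w) and h(w), read as
    plain concatenations of images of letters, are the same word.  The letter
    maps are marked: the images of distinct letters start differently.  Call a
    nonempty solution primitive if no proper nonempty prefix of it is a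
    solution.  Every solution is a product of primitive ones, and a primitive
    solution is determined by its first letter ([primitive_uniq]): after a
    prefix whose two images have different lengths, the longer image dictates
    the next letter.  Hence the primitive solutions, one from each pair of
    mutually inverse ones, form a basis ([primitives_basis]), and an automaton
    for Eq(g,h) only has to remember what it has read since the last solution
    ([reaches_step]).  What makes this effective is a computable bound on the
    length of the primitive solutions ([primitive_size]).

    The bound comes from the reduction step used for the Post correspondence
    problem of marked morphisms.  For each letter x there is at most one
    minimal pair (u,v) of nonempty words with g(u) = h(v) and u starting with
    x, called a block; put g'(x) = u and h'(x) = v, and leave them undefined if
    there is no block.  The pair (g',h') is the successor of (g,h).
    It is marked again, and g(u) = h(v) holds exactly for the images u = g'(z),
    v = h'(z) of a common word ([successor_factor]).  So a primitive solution w
    of (g,h) is g'(z) for a primitive solution z of (g',h') with the same first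
    letter, and z is shorter than w unless w is a single letter
    ([primitive_successor]).  The sizes of the maps stay bounded: the rest of a
    block is determined by the overhang at the current point, and this
    overhang is a proper suffix of an image of the other map, so passing to
    the successor does not increase the number of proper suffixes
    ([successor_suffix_bound]).  All iterated successors therefore lie in a
    finite set, two of them coincide ([repeated_instance]), and there the
    primitive solutions with a given first letter coincide as well, so that
    their length is 1.  Going back multiplies lengths by a bounded factor at
    each of boundedly many steps.

    Both algorithms enumerate all reduced words up to that bound.  That WHILE
    programs can do this follows from closure properties of the functions that
    they compute: those functions are closed under composition, pairing, case
    distinction and folding over lists ([computable_foldl]), which yields all
    the list functions in which the two algorithms are written. *)

(** * Functions computed by WHILE programs *)

Class encoding (T : Type) := enc : T -> tree.
#[export] Instance encoding_nat : encoding nat := enc_nat.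
#[export] Instance encoding_bool : encoding bool := enc_bool.
#[export] Instance encoding_unit : encoding unit := fun=> Leaf.
#[export] Instance encoding_seq T {_ : encoding T} : encoding (seq T) := enc_list enc.
#[export] Instance encoding_prod T U {_ : encoding T} {_ : encoding U} :
  encoding (T * U) := fun x => Node (enc x.1) (enc x.2).

Definition computable T U {_ : encoding T} {_ : encoding U} (f : T -> U) : Prop :=
  exists p, forall x, exec p (enc x) (enc (f x)).

(** [expr_hd] and [cmd_hd] relocate a program to the head of the single
    variable, which leaves the tail free to store data that must survive. *)
Fixpoint expr_hd (e : expr) : expr :=
  match e with
  | EVar => EHd EVar
  | ENil => ENil
  | ECons e1 e2 => ECons (expr_hd e1) (expr_hd e2)
  | EHd e1 => EHd (expr_hd e1)
  | ETl e1 => ETl (expr_hd e1)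
  end.

Fixpoint cmd_hd (c : cmd) : cmd :=
  match c with
  | Assign e => Assign (ECons (expr_hd e) (ETl EVar))
  | Seq c1 c2 => Seq (cmd_hd c1) (cmd_hd c2)
  | If e c1 c2 => If (expr_hd e) (cmd_hd c1) (cmd_hd c2)
  | While e c => While (expr_hd e) (cmd_hd c)
  end.

Lemma eval_expr_hd e s t : eval (expr_hd e) (Node s t) = eval e s.
Proof. by elim: e => //= [e1 -> e2 ->|e1 ->|e1 ->]. Qed.

Lemma exec_cmd_hd c s s' t :
  exec c s s' -> exec (cmd_hd c) (Node s t) (Node s' t).
Proof.
elim=> {c s s'} /=.
- move=> e s; have := ExecAssign (ECons (expr_hd e) (ETl EVar)) (Node s t).
  by rewrite /= eval_expr_hd.
- by move=> c1 c2 s1 s2 s3 _ IH1 _ IH2; apply: ExecSeq IH1 IH2.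
- move=> e c1 c2 s s' _ IH; apply: ExecIf; rewrite eval_expr_hd.
  by case: ifP IH.
- by move=> e c s se; apply: ExecWhileEnd; rewrite eval_expr_hd.
- move=> e c s1 s2 s3 se _ IH1 _ IH2.
  by apply: ExecWhileStep IH1 IH2; rewrite eval_expr_hd.
Qed.

Lemma exec_assign e s t : eval e s = t -> exec (Assign e) s t.
Proof. by move<-; apply: ExecAssign. Qed.

Generalizable Variables X T U Z.

Lemma eq_computable `{encoding X, encoding T} (f g : X -> T) :
  f =1 g -> computable f -> computable g.
Proof. by move=> fg [p pP]; exists p => x; rewrite -fg. Qed.

Lemma computable_id `{encoding X} : computable (fun x : X => x).
Proof. by exists (Assign EVar) => x; apply: exec_assign. Qed.

Lemma computable_comp `{encoding X, encoding T, encoding U}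
    (f : T -> U) (a : X -> T) :
  computable f -> computable a -> computable (fun x => f (a x)).
Proof. by move=> [p pP] [q qP]; exists (Seq q p) => x; apply: ExecSeq. Qed.

Lemma computable_const `{encoding X, encoding T} (c : T) :
  computable (fun _ : X => c).
Proof.
pose fix quote t := if t is Node t1 t2 then ECons (quote t1) (quote t2) else ENil.
exists (Assign (quote (enc c))) => x; apply: exec_assign.
by elim: (enc c) => //= t1 -> t2 ->.
Qed.

Lemma computable_fst `{encoding T, encoding U} : computable (@fst T U).
Proof. by exists (Assign (EHd EVar)) => x; apply: exec_assign. Qed.

Lemma computable_snd `{encoding T, encoding U} : computable (@snd T U).
Proof. by exists (Assign (ETl EVar)) => x; apply: exec_assign. Qed.

(** The program for one component runs on one copy of the input while the other
    copy is stored in the tail. *)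
Lemma computable_pair `{encoding X, encoding T, encoding U}
    (a : X -> T) (b : X -> U) :
  computable a -> computable b -> computable (fun x => (a x, b x)).
Proof.
move=> [p pP] [q qP].
pose swap := Assign (ECons (ETl EVar) (EHd EVar)).
exists (Seq (Assign (ECons EVar EVar))
       (Seq (cmd_hd p) (Seq swap (Seq (cmd_hd q) swap)))) => x.
apply: ExecSeq (exec_assign (erefl _)) _ => /=.
apply: ExecSeq (exec_cmd_hd _ (pP x)) _.
apply: ExecSeq (exec_assign (erefl _)) _ => /=.
by apply: ExecSeq (exec_cmd_hd _ (qP x)) (exec_assign _).
Qed.

Lemma computable_app2 `{encoding X, encoding T, encoding U, encoding Z}
    (f : T -> U -> Z) (a : X -> T) (b : X -> U) :
  computable (fun z => f z.1 z.2) -> computable a -> computable b ->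
  computable (fun x => f (a x) (b x)).
Proof.
move=> cf ca cb; apply: (computable_comp (a := fun x => (a x, b x)) cf).
exact: computable_pair.
Qed.

Lemma computable_if `{encoding X, encoding T} (b : X -> bool) (f g : X -> T) :
  computable b -> computable f -> computable g ->
  computable (fun x => if b x then f x else g x).
Proof.
move=> cb [p pP] [q qP]; have [r rP] := computable_pair cb computable_id.
exists (Seq r (If (EHd EVar) (Seq (Assign (ETl EVar)) p)
                             (Seq (Assign (ETl EVar)) q))) => x.
apply: ExecSeq (rP x) (ExecIf _).
rewrite (_ : truthy _ = b x) /=; last by case: (b x).
case: (b x).
  by apply: (@ExecSeq _ _ _ (enc x)); first exact: exec_assign.
by apply: (@ExecSeq _ _ _ (enc x)); first exact: exec_assign.
Qed.

(** A list and the pair of its head and tail have the same encoding. *)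
Lemma computable_cons `{encoding T} :
  computable (fun z : T * seq T => z.1 :: z.2).
Proof. by exists (Assign EVar) => z; apply: exec_assign. Qed.

Lemma computable_succ : computable succn.
Proof. by exists (Assign (ECons ENil EVar)) => n; apply: exec_assign. Qed.

Lemma computable_pred : computable predn.
Proof. by exists (Assign (ETl EVar)) => -[|n]; apply: exec_assign. Qed.

Lemma computable_nilp `{encoding T} : computable (@nilp T).
Proof.
exists (If EVar (Assign ENil) (Assign (ECons ENil ENil))) => -[|a t];
  by apply: ExecIf => /=; apply: exec_assign.
Qed.

Lemma computable_behead `{encoding T} : computable (@behead T).
Proof. by exists (Assign (ETl EVar)) => -[|a t]; apply: exec_assign. Qed.

Lemma computable_head `{encoding T} :
  computable (fun z : T * seq T => head z.1 z.2).
Proof.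
exists (If (ETl EVar) (Assign (EHd (ETl EVar))) (Assign (EHd EVar))).
by case=> c [|a t]; apply: ExecIf => /=; apply: exec_assign.
Qed.

(** The hints are keyed on the head function and closed by conversion, since
    the types that occur in goals may be canonical instances such as the sort of
    an [eqType], or [letter nat], in place of the types that they unfold to. *)
Create HintDb computable_db.
#[export] Hint Extern 0 (computable (@fst _ _)) =>
  exact computable_fst : computable_db.
#[export] Hint Extern 0 (computable (@snd _ _)) =>
  exact computable_snd : computable_db.
#[export] Hint Extern 0 (computable (fun _ => cons _ _)) =>
  exact computable_cons : computable_db.
#[export] Hint Extern 0 (computable succn) =>
  exact computable_succ : computable_db.
#[export] Hint Extern 0 (computable predn) =>
  exact computable_pred : computable_db.
#[export] Hint Extern 0 (computable (@nilp _)) =>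
  exact computable_nilp : computable_db.
#[export] Hint Extern 0 (computable (@behead _)) =>
  exact computable_behead : computable_db.
#[export] Hint Extern 0 (computable (fun _ => head _ _)) =>
  exact computable_head : computable_db.

(** Functions of several arguments are registered in uncurried form. *)
Ltac computable_step :=
  match goal with
  | H : computable ?f |- computable ?f => exact H
  | |- computable (fun x => x) => exact computable_id
  | |- computable (fun _ => ?c) => exact (computable_const c)
  | |- computable (fun x => (@?a x, @?b x)) =>
      refine (computable_pair (a := a) (b := b) _ _)
  | |- computable ?f => solve [auto with computable_db nocore]
  | H : computable ?f |- computable (fun x => ?f (@?a x)) =>
      refine (computable_comp (a := a) H _)
  | |- computable (fun x => ?f (@?a x)) =>
      refine (computable_comp (f := f) (a := a) _ _);
      [solve [auto with computable_db nocore] | ]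
  | H : computable (fun z => ?f z.1 z.2)
      |- computable (fun x => ?f (@?a x) (@?b x)) =>
      refine (computable_app2 (a := a) (b := b) H _ _)
  | |- computable (fun x => ?f (@?a x) (@?b x)) =>
      refine (computable_app2 (f := f) (a := a) (b := b) _ _ _);
      [solve [auto with computable_db nocore] | | ]
  | H : computable (fun z => ?f z.1.1 z.1.2 z.2)
      |- computable (fun x => ?f (@?a x) (@?b x) (@?c x)) =>
      refine (computable_comp (a := fun x => (a x, b x, c x)) H _)
  | |- computable (fun x => if _ then _ else _) => refine (computable_if _ _ _)
  end.

Ltac computability := repeat (cbn beta; computable_step).

(** The state of the loop is the list that remains to be read, the parameter
    and the value so far; as a nonempty list is encoded like a pair, the body is
    itself a function of tuples to which the rules above apply. *)
Lemma computable_foldl `{encoding X, encoding Z, encoding T}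
    (f : X -> Z -> T -> Z) (s0 : X -> Z) (l : X -> seq T) :
  computable (fun z : (X * Z) * T => f z.1.1 z.1.2 z.2) ->
  computable s0 -> computable l ->
  computable (fun x => foldl (f x) (s0 x) (l x)).
Proof.
move=> cf cs cl.
have cz : computable (fun x => (l x, (x, s0 x))) by computability.
pose body (z : (T * seq T) * (X * Z)) :=
  (z.1.2, (z.2.1, f z.2.1 z.2.2 z.1.1)).
have [p pP] : computable body.
  by rewrite /body; computability.
have [q qP] := cz; exists (Seq q (Seq (While (EHd EVar) p)
                             (Assign (ETl (ETl EVar))))) => x.
have loop r s : exec (While (EHd EVar) p)
    (enc (r, (x, s))) (enc ([::] : seq T, (x, foldl (f x) s r))).
  elim: r s => [|a r IHr] s; first exact: ExecWhileEnd.
  exact: (ExecWhileStep (e := EHd EVar) (s1 := enc (a :: r, (x, s))) isT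
           (pP ((a, r), (x, s))) (IHr _)).
exact: ExecSeq (qP x) (ExecSeq (loop _ _) (exec_assign _)).
Qed.

Lemma computable_iter `{encoding X, encoding Z} (f : X -> Z -> Z)
    (n : X -> nat) (s0 : X -> Z) :
  computable (fun z : X * Z => f z.1 z.2) -> computable n -> computable s0 ->
  computable (fun x => iter (n x) (f x) (s0 x)).
Proof.
move=> cf cn cs; pose l x := nseq (n x) tt.
have cl : computable l.
  (* A number is encoded as a list of that many trivial elements. *)
  apply: (computable_comp (f := nseq^~ tt)) cn.
  exists (Assign EVar) => k; apply: exec_assign => /=.
  by elim: k => //= k IHk; congr (Node Leaf _).
apply: (eq_computable (f := fun x => foldl (fun s _ => f x s) (s0 x) (l x))).
  by move=> x; rewrite /l; elim: (n x) (s0 x) => //= k IHk s; rewrite IHk -iterSr.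
by apply: computable_foldl => //; computability.
Qed.

Lemma computable_add : computable (fun z => addn z.1 z.2).
Proof.
apply: (eq_computable (f := fun z => iter z.1 succn z.2)).
  by move=> z; rewrite iter_succn addnC.
by apply: computable_iter; computability.
Qed.

Lemma computable_sub : computable (fun z => subn z.1 z.2).
Proof.
apply: (eq_computable (f := fun z => iter z.2 predn z.1)).
  by case=> m; elim=> [|k IHk]; rewrite ?subn0 //= subnS -IHk.
by apply: computable_iter; computability.
Qed.

#[export] Hint Extern 0 (computable (fun _ => addn _ _)) =>
  exact computable_add : computable_db.
#[export] Hint Extern 0 (computable (fun _ => subn _ _)) =>
  exact computable_sub : computable_db.

Lemma computable_mul : computable (fun z => muln z.1 z.2).
Proof.
apply: (eq_computable (f := fun z => iter z.1 (addn z.2) 0)).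
  by move=> z; rewrite iter_addn_0 mulnC.
by apply: computable_iter; computability.
Qed.
#[export] Hint Extern 0 (computable (fun _ => muln _ _)) =>
  exact computable_mul : computable_db.

Lemma computable_exp : computable (fun z => expn z.1 z.2).
Proof.
apply: (eq_computable (f := fun z => iter z.2 (muln z.1) 1)).
  by move=> z; rewrite iter_muln_1.
by apply: computable_iter; computability.
Qed.
#[export] Hint Extern 0 (computable (fun _ => expn _ _)) =>
  exact computable_exp : computable_db.

Lemma computable_andb : computable (fun z => andb z.1 z.2).
Proof.
by apply: (eq_computable (f := fun z => if z.1 then z.2 else false)) => //;
  computability.
Qed.

Lemma computable_orb : computable (fun z => orb z.1 z.2).
Proof.
by apply: (eq_computable (f := fun z => if z.1 then true else z.2)) => //;
  computability.
Qed.

Lemma computable_negb : computable negb.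
Proof.
by apply: (eq_computable (f := fun b => if b then false else true)) => //;
  computability.
Qed.
#[export] Hint Extern 0 (computable (fun _ => andb _ _)) =>
  exact computable_andb : computable_db.
#[export] Hint Extern 0 (computable (fun _ => orb _ _)) =>
  exact computable_orb : computable_db.
#[export] Hint Extern 0 (computable negb) =>
  exact computable_negb : computable_db.

Lemma computable_rev `{encoding T} : computable (@rev T).
Proof.
apply: (eq_computable (f := fun s => foldl (fun t a => a :: t) [::] s)).
  by move=> s; rewrite /rev; elim: s [::] => //=.
by apply: computable_foldl; computability.
Qed.
#[export] Hint Extern 0 (computable (@rev _)) =>
  exact computable_rev : computable_db.

Lemma computable_foldr `{encoding X, encoding Z, encoding T}
    (f : X -> T -> Z -> Z) (s0 : X -> Z) (l : X -> seq T) :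
  computable (fun z : (X * T) * Z => f z.1.1 z.1.2 z.2) ->
  computable s0 -> computable l ->
  computable (fun x => foldr (f x) (s0 x) (l x)).
Proof.
move=> cf cs cl.
apply: (eq_computable
  (f := fun x => foldl (fun s a => f x a s) (s0 x) (rev (l x)))).
  by move=> x; rewrite foldl_rev.
by apply: computable_foldl; computability.
Qed.
Lemma computable_cat `{encoding T} : computable (fun z : seq T * seq T => cat z.1 z.2).
Proof.
apply: (eq_computable (f := fun z => foldr cons z.2 z.1)).
  by case=> s t /=; elim: s => //= a s ->.
by apply: computable_foldr; computability.
Qed.
#[export] Hint Extern 0 (computable (fun _ => cat _ _)) =>
  exact computable_cat : computable_db.

Lemma computable_map `{encoding X, encoding T, encoding U}
    (f : X -> T -> U) (l : X -> seq T) :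
  computable (fun z : X * T => f z.1 z.2) -> computable l ->
  computable (fun x => map (f x) (l x)).
Proof.
move=> cf cl.
apply: (eq_computable (f := fun x => foldr (fun a s => f x a :: s) [::] (l x))).
  by move=> x; elim: (l x) => //= a s ->.
by apply: computable_foldr; computability.
Qed.

Lemma computable_filter `{encoding X, encoding T}
    (p : X -> T -> bool) (l : X -> seq T) :
  computable (fun z : X * T => p z.1 z.2) -> computable l ->
  computable (fun x => filter (p x) (l x)).
Proof.
move=> cp cl.
apply: (eq_computable
  (f := fun x => foldr (fun a s => if p x a then a :: s else s) [::] (l x))).
  by move=> x; elim: (l x) => //= a s ->.
by apply: computable_foldr; computability.
Qed.

Lemma computable_has `{encoding X, encoding T}
    (p : X -> T -> bool) (l : X -> seq T) :
  computable (fun z : X * T => p z.1 z.2) -> computable l ->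
  computable (fun x => has (p x) (l x)).
Proof.
move=> cp cl.
apply: (eq_computable (f := fun x => foldr (fun a b => p x a || b) false (l x))).
  by move=> x; elim: (l x) => //= a s ->.
by apply: computable_foldr; computability.
Qed.
Ltac computability ::=
  repeat (cbn beta; first
    [ computable_step
    | lazymatch goal with
      | |- computable (fun x => foldl (@?f x) (@?s x) (@?l x)) =>
          refine (computable_foldl (f := f) (s0 := s) (l := l) _ _ _)
      | |- computable (fun x => iter (@?n x) (@?f x) (@?s x)) =>
          refine (computable_iter (f := f) (n := n) (s0 := s) _ _ _)
      | |- computable (fun x => foldr (@?f x) (@?s x) (@?l x)) =>
          refine (computable_foldr (f := f) (s0 := s) (l := l) _ _ _)
      | |- computable (fun x => map (@?f x) (@?l x)) =>
          refine (computable_map (f := f) (l := l) _ _)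
      | |- computable (fun x => filter (@?f x) (@?l x)) =>
          refine (computable_filter (p := f) (l := l) _ _)
      | |- computable (fun x => has (@?f x) (@?l x)) =>
          refine (computable_has (p := f) (l := l) _ _)
      end ]).

Lemma computable_flatten `{encoding T} : computable (@flatten T).
Proof.
apply: (eq_computable (f := fun s => foldr cat [::] s)) => //.
by computability.
Qed.

Lemma computable_size `{encoding T} : computable (@size T).
Proof.
apply: (eq_computable (f := fun s => foldr (fun _ n => n.+1) 0 s)).
  by elim=> //= a s ->.
by computability.
Qed.

Lemma computable_iota0 : computable (iota 0).
Proof.
apply: (eq_computable
  (f := fun n => iter n (fun s => 0 :: map succn s) [::])).
  by elim=> //= n ->; rewrite -(iotaDl 1).
by computability.
Qed.

Lemma computable_nth `{encoding T} (c : T) :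
  computable (fun z : seq T * nat => nth c z.1 z.2).
Proof.
apply: (eq_computable (f := fun z => head c (iter z.2 behead z.1))).
  case=> s n /=; rewrite -nth0 -(addn0 n) -nth_drop addn0; congr nth.
  elim: n => [|n IHn]; first by rewrite drop0.
  by rewrite /= IHn -drop1 drop_drop add1n.
by computability.
Qed.
#[export] Hint Extern 0 (computable (@flatten _)) =>
  exact computable_flatten : computable_db.
#[export] Hint Extern 0 (computable (@size _)) =>
  exact computable_size : computable_db.
#[export] Hint Extern 0 (computable (iota 0)) =>
  exact computable_iota0 : computable_db.
#[export] Hint Extern 0 (computable (fun _ => nth _ _ _)) =>
  exact (computable_nth _) : computable_db.

Lemma computable_eq_nat : computable (fun z : nat * nat => z.1 == z.2).
Proof.
have c0 : computable (eq_op 0).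
  exists (If EVar (Assign ENil) (Assign (ECons ENil ENil))) => -[|n];
  by apply: ExecIf => /=; apply: exec_assign.
apply: (eq_computable (f := fun z => eq_op 0 ((z.1 - z.2) + (z.2 - z.1)))).
  by move=> z; rewrite eq_sym addn_eq0 !subn_eq0 -eqn_leq.
by computability.
Qed.

Lemma computable_eq_bool : computable (fun z : bool * bool => z.1 == z.2).
Proof.
apply: (eq_computable (f := fun z => if z.1 then z.2 else ~~ z.2)).
  by case=> [[] []].
by computability.
Qed.

Lemma computable_eq_prod (T U : eqType) {eT : encoding T} {eU : encoding U} :
  computable (fun z : T * T => z.1 == z.2) ->
  computable (fun z : U * U => z.1 == z.2) ->
  computable (fun z : (T * U) * (T * U) => z.1 == z.2).
Proof.
move=> cT cU.
apply: (eq_computable (f := fun z => (z.1.1 == z.2.1) && (z.1.2 == z.2.2))).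
  by [].
by computability.
Qed.

(** One list is read while the other is consumed in the state. *)
Lemma computable_eq_seq (T : eqType) {eT : encoding T} :
  computable (fun z : T * T => z.1 == z.2) ->
  computable (fun z : seq T * seq T => z.1 == z.2).
Proof.
move=> cT; pose step (z : seq T * bool) a :=
  (behead z.1, z.2 && (~~ nilp z.1 && (a == head a z.1))).
apply: (eq_computable (f := fun z =>
  nilp (foldl step (z.2, true) z.1).1 && (foldl step (z.2, true) z.1).2)).
  case=> s t /=; rewrite -[RHS]/(true && (s == t)).
  elim: s t true => [|a s IHs] t c; first by case: t; case: c.
  by rewrite IHs; case: t => [|b t]; rewrite /= ?andbF // andbA.
by rewrite /step; computability.
Qed.
#[export] Hint Extern 0 (computable (fun _ => _ == _)) =>
  first [exact computable_eq_nat | exact computable_eq_bool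
    | refine (computable_eq_prod _ _) | refine (computable_eq_seq _)] : computable_db.

(** * Solutions of a pair of letter maps *)

Lemma size_neq0 (T : eqType) (s : seq T) : (s != [::]) = (0 < size s).
Proof. by case: s. Qed.

Lemma catI (T : eqType) (s t t' : seq T) : s ++ t = s ++ t' -> t = t'.
Proof. by move/eqP; rewrite eqseq_cat // eqxx => /eqP. Qed.

Lemma ohead_cat (T : eqType) (s t : seq T) : s != [::] -> ohead (s ++ t) = ohead s.
Proof. by case: s. Qed.

Definition extend (A B : Type) (f : A -> seq B) (w : seq A) : seq B :=
  flatten (map f w).

Lemma extend_cons (A B : Type) (f : A -> seq B) x w :
  extend f (x :: w) = f x ++ extend f w.
Proof. by []. Qed.

Lemma extend_cat (A B : Type) (f : A -> seq B) u v :
  extend f (u ++ v) = extend f u ++ extend f v.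
Proof. by rewrite /extend map_cat flatten_cat. Qed.

(** Letter maps may be partial; an empty image stands for no image. *)
Definition defined (A : Type) (B : eqType) (f : A -> seq B) (w : seq A) : bool :=
  all (fun x => f x != [::]) w.

Lemma defined_cons (A : Type) (B : eqType) (f : A -> seq B) x w :
  defined f (x :: w) = (f x != [::]) && defined f w.
Proof. by []. Qed.

Definition marked (A B : eqType) (f : A -> seq B) : Prop :=
  forall x y, f x != [::] -> ohead (f x) = ohead (f y) -> x = y.

Section Solutions.
Variables (A B : eqType) (I : (A -> seq B) * (A -> seq B)).
Implicit Types u v w : seq A.

Definition solution w : bool :=
  [&& defined I.1 w, defined I.2 w & extend I.1 w == extend I.2 w].

Definition primitive w : Prop :=
  [/\ solution w, w != [::] &
      forall u v, w = u ++ v -> solution u -> u = [::] \/ v = [::]].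

Lemma solution_catl u v :
  solution u -> solution (u ++ v) = solution v.
Proof.
case/and3P=> d1 d2 /eqP E; rewrite /solution /defined !all_cat !extend_cat -E.
by rewrite [all _ u]d1 [all _ u]d2 eqseq_cat // eqxx.
Qed.

Lemma primitive_prefix w :
  solution w -> w != [::] -> exists p r, w = p ++ r /\ primitive p.
Proof.
have [m] := ubnP (size w); elim: m w => // m IHm w szw sw w0.
have [[u [v [wE su u0 v0]]]|nsplit] := classic (exists u v,
    [/\ w = u ++ v, solution u, u != [::] & v != [::]]).
  have [|p [r [uE pP]]] := IHm u _ su u0.
    by move: szw v0; rewrite wE size_cat size_neq0; lia.
  by exists p, (r ++ v); rewrite wE uE catA.
exists w, [::]; rewrite cats0; split=> //; split=> // u v wE su.
case: (altP (u =P [::])) => [|u0]; first by left.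
case: (altP (v =P [::])) => [|v0]; first by right.
by case: nsplit; exists u, v.
Qed.

(** Compare two primitive solutions letter by letter after a common nonempty
    prefix c.  The two images of c differ, as c is not a solution, so one of
    them is a proper prefix of the other and the next letter is the one whose
    image starts as the longer image of c goes on. *)
Lemma primitive_uniq w w' :
  marked I.1 -> marked I.2 -> primitive w -> primitive w' ->
  ohead w = ohead w' -> w = w'.
Proof.
move=> m1 m2 wI w'I hd.
suff main u c v : c != [::] -> primitive (c ++ u) -> primitive (c ++ v) -> u = v.
  case: w w' hd wI w'I => [|x w] [|x' w'] //= [<-] wI w'I; try by case: wI.
  by congr (_ :: _); apply: (main w [:: x] w').
elim: u c v => [|y u IHu] c v c0 pu pv.
  have [su _ _] := pu; rewrite cats0 in su; have [_ _ vP] := pv.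
  by have [c00|->] := vP c v erefl su; first by rewrite c00 in c0.
case: v pv => [|y' v] pv.
  have [sv _ _] := pv; rewrite cats0 in sv; have [_ _ uP] := pu.
  by have [c00|//] := uP c (y :: u) erefl sv; rewrite c00 in c0.
suff yy : y = y'.
  rewrite -yy -!cat_rcons in pu pv *; congr (_ :: _).
  by apply: IHu pu pv; rewrite size_neq0 size_rcons.
have [su _ uP] := pu; have [sv _ _] := pv.
have {uP} nc : extend I.1 c != extend I.2 c.
  apply/negP => E; have sc : solution c.
    move: su; rewrite /solution /defined !all_cat.
    by case/and3P=> /andP[-> _] /andP[-> _] _.
  by have [c00|//] := uP c (y :: u) erefl sc; rewrite c00 in c0.
move: su sv; rewrite /solution !extend_cat !extend_cons /defined !all_cat.
case/and3P=> /andP[_ /andP[gy _]] /andP[_ /andP[hy _]] /eqP E.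
case/and3P=> /andP[_ /andP[gy' _]] /andP[_ /andP[hy' _]] /eqP E'.
(* The longer image of c dictates how the shorter one goes on. *)
have key (f k : A -> seq B) s s' t t' :
    marked f -> f y != [::] -> f y' != [::] -> size (extend f c) < size (extend k c) ->
    extend f c ++ f y ++ s = extend k c ++ t ->
    extend f c ++ f y' ++ s' = extend k c ++ t' ->
    y = y'.
  move=> mf fy fy' lt_c Et Et'.
  have kE : extend k c = extend f c ++ drop (size (extend f c)) (extend k c).
    rewrite -{1}[extend k c](cat_take_drop (size (extend f c))); congr (_ ++ _).
    have := congr1 (take (size (extend f c))) Et.
    by rewrite (take_size_cat (f y ++ s) (erefl _)) take_cat lt_c.
  set r := drop _ _ in kE; have r0 : r != [::] by rewrite size_neq0 size_drop subn_gt0.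
  move: Et Et'; rewrite kE -!catA => /catI/(congr1 ohead) + /catI/(congr1 ohead).
  by rewrite !ohead_cat // => <- yy; apply: mf.
have [lt_c|lt_c|eq_c] := ltngtP (size (extend I.1 c)) (size (extend I.2 c)).
- exact: key lt_c E E'.
- exact: key lt_c (esym E) (esym E').
- by move/eqP: E; rewrite eqseq_cat // (negPf nc).
Qed.

End Solutions.

(** * Runs *)

Section Runs.
Variables A B : eqType.
Implicit Types (g h : A -> seq B) (s : seq B) (u v w : seq A).

(** In [run g h s u v] the word s is an overhang: h is ahead of g by s.  The run
    appends letters, to u when g is behind and to v when h is behind, until both
    images have the same length for the first time.  The roles of g and h are
    swapped whenever the overhang changes sides. *)
Inductive run : (A -> seq B) -> (A -> seq B) -> seq B -> seq A -> seq A -> Prop :=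
| RunEnd g h y : g y != [::] -> run g h (g y) [:: y] [::]
| RunStay g h y s u v :
    g y != [::] -> run g h s u v -> run g h (g y ++ s) (y :: u) v
| RunSwap g h y s s' u v :
    s != [::] -> g y = s ++ s' -> run h g s' v u -> run g h s (y :: u) v.

Lemma run_pending g h s u v : run g h s u v -> s != [::].
Proof. by case=> // {}g {}h y {}s {}u {}v; case: (g y). Qed.

Lemma run_eq g h s u v : run g h s u v -> s ++ extend h v = extend g u.
Proof.
elim=> {g h s u v} [g h y _|g h y s u v _ _ IH|g h y s s' u v _ gy _ IH].
- by rewrite /extend /= !cats0.
- by rewrite -catA IH.
- by rewrite -IH catA -gy.
Qed.

Lemma run_inv g h s u v : run g h s u v ->
  exists y u', [/\ u = y :: u', g y != [::], ohead (g y) = ohead s &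
    [\/ [/\ s = g y, u' = [::] & v = [::]],
        exists2 s', s = g y ++ s' & run g h s' u' v |
        exists2 s', g y = s ++ s' & run h g s' v u']].
Proof.
case=> {g h s u v} [g h y gy|g h y s u v gy r|g h y s s' u v s0 gy r];
  exists y; eexists; split; first [by [] | by rewrite ?gy ohead_cat | idtac].
- by constructor 1.
- by constructor 2; exists s.
- by rewrite gy; case: (s) s0.
- by constructor 3; exists s'.
Qed.

(** The side that is behind has no choice: its next letter is the one whose
    image starts with the first letter of the overhang. *)
Lemma run_det g h s u v u' v' : marked g -> marked h ->
  run g h s u v -> run g h s u' v' -> u = u' /\ v = v'.
Proof.
move=> mg mh r; elim: r mg mh u' v' => {g h s u v}
  [g h y gy|g h y s u v gy r IH|g h y s s' u v s0 gy r IH] mg mh u' v' r';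
  have [z [w [-> gz hz]]] := run_inv r';
  have {hz} E : z = y by apply: mg gz _;
    rewrite hz ?ohead_cat // gy ohead_cat // size_neq0.
all: subst z.
- move=> [[_ -> ->] //|[t /(congr1 size) st /run_pending]|
    [t /(congr1 size) st /run_pending]];
    by move: st; rewrite size_neq0 size_cat; lia.
- move=> [[/(congr1 size) st _ _]|[t /catI <- /(IH mg mh)[-> ->] //]|
    [t /(congr1 size) st /run_pending]];
    by move: st (run_pending r); rewrite !size_neq0 !size_cat; lia.
- move=> [[st _ _]|[t st /run_pending]|[t]];
    last by rewrite gy => /catI <- /(IH mh mg)[-> ->].
  + by move: (run_pending r) (congr1 size gy); rewrite st size_neq0 size_cat; lia.
  + move: (run_pending r) (congr1 size gy).
    by rewrite st !size_neq0 !size_cat; lia.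
Qed.

(** A run stops at the first point where the images of prefixes of u and v have
    the same length; the rest is then an equation without overhang. *)
Lemma run_split g h s u v : s != [::] -> defined g u -> defined h v ->
  s ++ extend h v = extend g u ->
  exists u1 u2 v1 v2, [/\ u = u1 ++ u2, v = v1 ++ v2, run g h s u1 v1 &
    extend h v2 = extend g u2].
Proof.
have [n] := ubnP (size u + size v); elim: n g h s u v => // n IHn g h s u v.
case: u => [|y u] szn s0 du dv E; first by case: s s0 E.
have /andP[gy du'] : (g y != [::]) && defined g u := du.
have {}E : s ++ extend h v = g y ++ extend g u by [].
have [lt_s|lt_s|eq_s] := ltngtP (size s) (size (g y)).
- have gyE : g y = s ++ drop (size s) (g y).
    rewrite -{1}[g y](cat_take_drop (size s)); congr (_ ++ _).
    by have := congr1 (take (size s)) E; rewrite take_size_cat // take_cat lt_s.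
  set s' := drop _ _ in gyE.
  have s'0 : s' != [::] by rewrite size_neq0 size_drop subn_gt0.
  have E' : s' ++ extend g u = extend h v by move: E; rewrite gyE -catA => /catI.
  have [|v1 [v2 [u1 [u2 [-> -> r E2]]]]] := IHn h g s' v u _ s'0 dv du' E'.
    by move: szn => /=; lia.
  exists (y :: u1), u2, v1, v2; split=> //; exact: RunSwap gyE r.
- have sE : s = g y ++ drop (size (g y)) s.
    rewrite -{1}[s](cat_take_drop (size (g y))); congr (_ ++ _).
    have := congr1 (take (size (g y))) E.
    by rewrite (take_size_cat (extend g u) (erefl _)) take_cat lt_s.
  set s' := drop _ _ in sE.
  have s'0 : s' != [::] by rewrite size_neq0 size_drop subn_gt0.
  have E' : s' ++ extend h v = extend g u by move: E; rewrite sE -catA => /catI.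
  have [|u1 [u2 [v1 [v2 [-> -> r E2]]]]] := IHn g h s' u v _ s'0 du' dv E'.
    by move: szn => /=; lia.
  exists (y :: u1), u2, v1, v2; split=> //; rewrite sE; exact: RunStay gy r.
- move/eqP: E; rewrite eqseq_cat // => /andP[/eqP-> /eqP E].
  by exists [:: y], u, [::], v; split=> //; apply: RunEnd.
Qed.

End Runs.

(** * The successor of a pair of marked maps *)

Section Successor.
Variables A B : eqType.
Implicit Types (g h : A -> seq B) (s t : seq B) (u v w : seq A).

(** A block is a minimal pair of nonempty words with equal images; it is indexed
    by the first letter x of its first word, after which g is ahead by [g x]. *)
Definition block g h x (p : seq A * seq A) : Prop :=
  exists2 u, p.1 = x :: u & run h g (g x) p.2 u.

Definition block_at g h x : seq A * seq A :=
  epsilon (inhabits ([::], [::])) (fun p => block g h x p \/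
    p = ([::], [::]) /\ forall q, ~ block g h x q).

Lemma block_atP g h x : block g h x (block_at g h x) \/
  block_at g h x = ([::], [::]) /\ forall q, ~ block g h x q.
Proof.
apply: (epsilon_spec (inhabits ([::], [::])) (fun p => block g h x p \/
  p = ([::], [::]) /\ forall q, ~ block g h x q)).
have [[p bp]|nob] := classic (exists p, block g h x p); first by exists p; left.
by exists ([::], [::]); right; split=> // q bq; apply: nob; exists q.
Qed.

Definition successor (I : (A -> seq B) * (A -> seq B)) :
    (A -> seq A) * (A -> seq A) :=
  (fun x => (block_at I.1 I.2 x).1, fun x => (block_at I.1 I.2 x).2).

Definition proper_suffix (f : A -> seq B) t : Prop :=
  exists a s, [/\ f a = s ++ t, s != [::] & t != [::]].

(** Distinct suffixes are counted as words, and not as occurrences in images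
    of letters, because different blocks may end in the same way. *)
Definition suffix_bound (f : A -> seq B) n : Prop :=
  exists2 L : seq (seq B), size L <= n & forall t, proper_suffix f t -> t \in L.

(** The proper suffixes of a single word have distinct lengths. *)
Lemma size_suffix_bound f n x : suffix_bound f n -> size (f x) <= n.+1.
Proof.
case=> L szL LP; pose sufs := [seq drop k (f x) | k <- iota 1 (size (f x)).-1].
have szs : size sufs = (size (f x)).-1 by rewrite size_map size_iota.
suff : size sufs <= size L by rewrite szs; lia.
apply: uniq_leq_size.
  rewrite map_inj_in_uniq ?iota_uniq // => i j; rewrite !mem_iota => hi hj.
  by move/(congr1 size); rewrite !size_drop; lia.
move=> t /mapP[k]; rewrite mem_iota => hk ->; apply: LP.
exists x, (take k (f x)); rewrite cat_take_drop !size_neq0.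
by rewrite size_drop size_take; split=> //; [case: ifP; lia | lia].
Qed.

Variable I : (A -> seq B) * (A -> seq B).
Hypothesis marked1 : marked I.1.
Hypothesis marked2 : marked I.2.
Local Notation g := I.1.
Local Notation h := I.2.
Local Notation g' := (successor I).1.
Local Notation h' := (successor I).2.

Lemma block_det x p q : block g h x p -> block g h x q -> p = q.
Proof.
case: p q => [p1 p2] [q1 q2] [u /= -> ru] [v /= -> rv].
by have [-> ->] := run_det marked2 marked1 ru rv.
Qed.

Lemma block_successor x p : block g h x p -> g' x = p.1 /\ h' x = p.2.
Proof.
move=> bp; rewrite /successor /=; case: (block_atP g h x) => [bq|[_ /(_ p)//]].
by rewrite (block_det bq bp).
Qed.

Variant successor_spec x : seq A -> seq A -> Prop :=
| SuccessorBlock y u v of run h g (g x) (y :: v) u & h y != [::]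
    & ohead (h y) = ohead (g x) :
    successor_spec x (x :: u) (y :: v)
| SuccessorNone : successor_spec x [::] [::].

Lemma successorP x : successor_spec x (g' x) (h' x).
Proof.
rewrite /successor /=; case: (block_atP g h x) => [|[-> _]]; last by constructor 2.
case: (block_at g h x) => [_ v] [u /= -> r].
have [y [v' [vE hy hd _]]] := run_inv r.
by rewrite vE in r *; constructor.
Qed.

(** The first letter of the block of x is x itself in the first map; in the
    second one it is the letter whose image under h starts like [g x]. *)
Lemma successor_marked : marked g' /\ marked h'.
Proof.
split=> x y; case: (successorP x) => // a u v r _ ha _;
  case: (successorP y) => // b u2 v2 r2 _ hb; first by case.
by case=> ab; apply: marked1; rewrite ?(run_pending r) // -ha -hb ab.
Qed.

Lemma extend_successor z : extend g (extend g' z) = extend h (extend h' z).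
Proof.
elim: z => // x z IHz; rewrite !extend_cons !extend_cat IHz; congr (_ ++ _).
by case: (successorP x) => // y u v /run_eq <- _ _.
Qed.

(** Cut both words at all the points where their images meet. *)
Lemma successor_factor u v :
  defined g u -> defined h v -> extend g u = extend h v ->
  exists z, [/\ defined g' z, defined h' z, u = extend g' z & v = extend h' z].
Proof.
have [n] := ubnP (size u); elim: n u v => // n IHn [|x u] v szu du dv E.
  exists [::]; split=> //; case: v dv E => //= y v /andP[hy _].
  by rewrite /extend /=; case: (h y) hy.
have /andP[gx du'] : (g x != [::]) && defined g u := du.
have [v1 [v2 [u1 [u2 [vE uE r E2]]]]] := run_split gx dv du' E.
have [|||z [dz1 dz2 u2E v2E]] := IHn u2 v2 _ _ _ E2.
- by move: szu; rewrite uE /= size_cat; lia.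
- by move: du'; rewrite uE /defined all_cat => /andP[].
- by move: dv; rewrite vE /defined all_cat => /andP[].
have [gE hE] := block_successor (p := (x :: u1, v1)) (ex_intro2 _ _ u1 erefl r).
have [y [v' [v1E _ _ _]]] := run_inv r.
exists (x :: z); rewrite !extend_cons !defined_cons dz1 dz2 gE hE -u2E -v2E uE vE.
by rewrite v1E.
Qed.

(** Cutting a run in the middle leaves a run from the overhang at that point,
    which is a proper suffix of an image of the map that is ahead. *)
Lemma run_suffix g h s u v :
  run g h s u v -> (exists a s0, h a = s0 ++ s) ->
  (forall u1 u2, u = u1 ++ u2 -> u1 != [::] -> u2 != [::] ->
     exists2 t, proper_suffix h t & exists w, run g h t u2 w) /\
  (forall v1 v2, v = v1 ++ v2 -> v2 != [::] ->
     exists2 t, proper_suffix g t & exists w, run h g t v2 w).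
Proof.
elim=> {g h s u v} [g h y _|g h y s u v gy r IH|g h y s s' u v s0 gyE r IH] [a [s1 aE]].
- by split; [move=> [|? [|? ?]] //= [|? ?] | move=> [|? ?] [|? ?]].
- have [|IH1 IH2] := IH; first by exists a, (s1 ++ g y); rewrite -catA.
  split=> // -[|z u1] // u2 [_ uE] _ u20.
  case: u1 uE => [|z' u1] /= uE; last exact: (IH1 (z' :: u1) _ uE isT u20).
  rewrite -uE; exists s; last by exists v.
  exists a, (s1 ++ g y); rewrite -catA aE (run_pending r).
  by split=> //; case: (s1) (g y) gy => [|? ?] [|? ?].
- have [|IH1 IH2] := IH; first by exists y, s.
  split=> [[|z u1] // u2 [_ uE] _ u20|[|z v1] v2 vE v20]; first exact: IH2 uE u20.
  + move: vE => /= <-; exists s'; last by exists u.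
    by exists y, s; rewrite (run_pending r).
  + exact: (IH1 (z :: v1) _ vE isT v20).
Qed.

End Successor.

Section SuccessorBound.
Variables (A B : eqType) (I : (A -> seq B) * (A -> seq B)).
Hypothesis marked1 : marked I.1.
Hypothesis marked2 : marked I.2.

(** As runs are deterministic, sending an overhang to the word that it forces
    covers all the suffixes in question. *)
Lemma suffix_bound_run (g h : A -> seq B) (f : A -> seq A) n :
  marked g -> marked h -> suffix_bound h n ->
  (forall t, proper_suffix f t ->
     exists2 s, proper_suffix h s & exists v, run g h s t v) ->
  suffix_bound f n.
Proof.
move=> mg mh [L szL LP] fP.
pose forced s := epsilon (inhabits [::]) (fun t => exists v, run g h s t v).
exists (map forced L); first by rewrite size_map.
move=> t /fP[s /LP sL [v r]]; apply/mapP; exists s => //.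
have := epsilon_spec (inhabits [::]) (fun t => exists v, run g h s t v).
rewrite -/(forced s) => -[|w r']; first by exists t, v.
by have [-> _] := run_det mg mh r r'.
Qed.

(** Suffixes in the first map of the successor are forced by overhangs of h, and
    suffixes in the second map by overhangs of g. *)
Lemma successor_suffix_bound n :
  suffix_bound I.1 n -> suffix_bound I.2 n ->
  suffix_bound (successor I).1 n /\ suffix_bound (successor I).2 n.
Proof.
move=> b1 b2; split.
  apply: (suffix_bound_run marked1 marked2 b2) => t [x [s [E s0 t0]]].
  case: (successorP I x) E => [y u v r _ _|E]; last by case: s E s0.
  case: s s0 => // z s _ [_ uE].
  have [|_ H] := run_suffix r; first by exists x, [::].
  exact: H uE t0.
apply: (suffix_bound_run marked2 marked1 b1) => t [x [s [E s0 t0]]].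
case: (successorP I x) E => [y u v r _ _|E]; last by case: s E s0.
move=> vE; have [|H _] := run_suffix r; first by exists x, [::].
exact: H vE s0 t0.
Qed.

(** If w is as long as z, then both maps of the successor send the first letter x
    of z to single letters.  These agree, both being the first letter of w, so
    that x is a solution by itself, and z is x by primitivity. *)
Lemma primitive_successor w : primitive I w ->
  exists z, [/\ primitive (successor I) z, w = extend (successor I).1 z,
                ohead z = ohead w, size z <= size w &
                size z = size w -> size w = 1].
Proof.
move=> [/and3P[d1 d2 /eqP E] w0 wP].
have [z [e1 e2 wE1 wE2]] := successor_factor marked1 marked2 d1 d2 E.
have hd : ohead z = ohead w.
  case: z {e2 wE2} e1 wE1 => [_ ->|x z] // /andP[gx _] ->.
  by rewrite extend_cons; case: (successorP I x) gx.
have zP u v : z = u ++ v -> solution (successor I) u -> u = [::] \/ v = [::].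
  move=> zE /and3P[_ _ /eqP uE].
  have nil f t : defined f t -> extend f t = [::] -> t = [::] :> seq A.
    by case: t => //= x t /andP[fx _]; rewrite extend_cons; case: (f x) fx.
  move: (e1); rewrite zE /defined all_cat => /andP[eu ev].
  have su : solution I (extend (successor I).1 u).
    move: d1 d2; rewrite {1}wE1 {1}wE2 zE !extend_cat /defined !all_cat.
    move=> /andP[d1 _] /andP[d2 _]; apply/and3P; split=> //; first by rewrite uE.
    by rewrite extend_successor uE.
  have wuv : w = extend (successor I).1 u ++ extend (successor I).1 v.
    by rewrite -extend_cat -zE.
  by have [E0|E0] := wP _ _ wuv su; [left; apply: nil eu E0|right; apply: nil ev E0].
have zS : solution (successor I) z by apply/and3P; split=> //; rewrite -wE1 -wE2.
have z0 : z != [::] by case: (z) wE1 w0 => // ->.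
have szf f t : defined f t -> size t <= size (extend f t).
  elim: t => //= x t IHt /andP[fx /IHt]; rewrite extend_cons size_cat.
  by move: fx; rewrite size_neq0; lia.
exists z; split=> //; first by rewrite wE1; apply: szf.
case: z {hd zS} zP z0 e1 e2 wE1 wE2 => // x t zP _.
rewrite !defined_cons !extend_cons => /andP[gx /szf gt] /andP[hx /szf ht] wE1 wE2.
have := congr1 size wE1; have := congr1 size wE2; rewrite !size_cat => sz2 sz1.
rewrite -[size (x :: t)]/(size t).+1 => tw.
have [s1 s2] : size ((successor I).1 x) = 1 /\ size ((successor I).2 x) = 1.
  by move: gx hx; rewrite !size_neq0; lia.
have t0 : t = [::].
  have gh : (successor I).1 x = (successor I).2 x.
    move: wE2 s1 s2; rewrite wE1.
    by case: (successorP I x) => // y [|? ?] [|? ?] _ _ _ // [->].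
  have sx : solution (successor I) [:: x].
    by rewrite /solution !defined_cons gx hx !extend_cons gh eqxx.
  by have [] := zP [:: x] t erefl sx.
by rewrite sz1 s1 t0.
Qed.

End SuccessorBound.

(** * A bound on the length of primitive solutions *)

Lemma extend_suffix_bound (A B : eqType) (f : A -> seq B) (s : seq A) n :
  (forall x, x \in s) -> size (extend f s) <= n -> suffix_bound f n.
Proof.
move=> sP le_n.
exists (flatten [seq [seq drop k (f x) | k <- iota 0 (size (f x))] | x <- s]).
  rewrite size_flatten /shape -map_comp (leq_trans _ le_n) //.
  rewrite /extend size_flatten /shape -map_comp leq_eqVlt; apply/orP; left.
  by apply/eqP; congr sumn; apply: eq_map => x /=; rewrite size_map size_iota.
move=> t [x [u [fx u0 t0]]]; apply/flatten_mapP; exists x => //.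
apply/mapP; exists (size u); last by rewrite fx drop_size_cat.
by move: t0; rewrite mem_iota fx size_cat size_neq0; lia.
Qed.

Section Iteration.
Variables (A : finType) (n : nat).
Implicit Type I : (A -> seq A) * (A -> seq A).

Definition bounded_pair (B : eqType) (I : (A -> seq B) * (A -> seq B)) :=
  [/\ marked I.1, marked I.2, suffix_bound I.1 n & suffix_bound I.2 n].

Lemma bounded_successor (B : eqType) (I : (A -> seq B) * (A -> seq B)) :
  bounded_pair I -> bounded_pair (successor I).
Proof.
case=> m1 m2 b1 b2; have [m1' m2'] := successor_marked m1.
by have [b1' b2'] := successor_suffix_bound m1 m2 b1 b2.
Qed.

Lemma size_extend_bound (B : eqType) (f : A -> seq B) w :
  suffix_bound f n -> size (extend f w) <= n.+1 * size w.
Proof.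
move=> fn; elim: w => // x w IHw; rewrite extend_cons size_cat mulnS leq_add //.
exact: size_suffix_bound.
Qed.

(** Lengths drop strictly along the iteration until they reach 1; this is what
    the last clause records. *)
Lemma iterated_successor I w k : bounded_pair I -> primitive I w ->
  exists z, [/\ primitive (iter k (@successor A A) I) z, ohead z = ohead w,
    size w <= n.+1 ^ k * size z, size z <= size w &
    0 < k -> size z = size w -> size w = 1].
Proof.
elim: k I w => [|k IHk] I w bI wI; first by exists w; rewrite mul1n.
have [m1 m2 b1 b2] := bI; have bI' := bounded_successor bI.
have [z [zI wE hz le_zw eq_zw]] := primitive_successor m1 m2 wI.
have [y [yI hy szy le_yz _]] := IHk _ _ bI' zI.
exists y; rewrite iterSr; split=> //; first by rewrite hy.
  have [_ _ b1' _] := bI'; rewrite wE (leq_trans (size_extend_bound _ b1')) //.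
  by rewrite expnS -mulnA leq_mul2l.
  exact: leq_trans le_yz le_zw.
by move=> _ eq_yw; apply: eq_zw; apply/eqP; rewrite eqn_leq le_zw -eq_yw.
Qed.

(** The number of ways to choose, for each letter and each of the two maps, a
    word of at most [n.+1] letters padded with [None]. *)
Definition instance_count : nat := #|A|.+1 ^ (#|A| * n.+1 * 2).

Lemma repeated_instance (J : nat -> (A -> seq A) * (A -> seq A)) :
  (forall k, bounded_pair (J k)) ->
  exists i j, [/\ i < j, j <= instance_count & J i = J j].
Proof.
move=> bJ.
pose code I := [ffun p : A * 'I_n.+1 * bool =>
  onth (if p.2 then I.1 p.1.1 else I.2 p.1.1) p.1.2].
have /injectivePn[i [j ij eq_code]] :
    ~~ injectiveb (fun k : 'I_instance_count.+1 => code (J k)).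
  apply/negP => /injectiveP/leq_card.
  rewrite card_ord card_ffun card_option !card_prod card_ord card_bool.
  by rewrite ltnn.
wlog lt_ij : i j ij eq_code / i < j.
  move=> H; have [|lt_ji|/val_inj ji] := ltngtP i j; first exact: H.
    by apply: (H j i); rewrite // eq_sym.
  by rewrite ji eqxx in ij.
exists i, j; split=> //; first by rewrite -ltnS.
have eqE (b : bool) x :
    (if b then (J i).1 x else (J i).2 x) = (if b then (J j).1 x else (J j).2 x).
  have le_n k : size (if b then (J k).1 x else (J k).2 x) <= n.+1.
    by have [_ _ b1 b2] := bJ k; case: b; apply: size_suffix_bound.
  apply: eq_from_onth => m; have [lt_m|le_m] := ltnP m n.+1.
    by have /ffunP/(_ (x, Ordinal lt_m, b)) := eq_code; rewrite !ffunE.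
  by rewrite !onth_default // (leq_trans (le_n _) le_m).
case: (J i) (J j) eqE => [g h] [g' h'] /= eqE.
by congr pair; apply: functional_extensionality => x;
  [apply: (eqE true) | apply: (eqE false)].
Qed.

(** At a repetition J i = J j among the iterated successors, the primitive
    solutions with the first letter of w are equal, and they can only have
    length 1; w is obtained from that letter by applying i + 1 maps whose images
    have at most [n.+1] letters. *)
Lemma primitive_size (B : eqType) (I : (A -> seq B) * (A -> seq B)) w :
  bounded_pair I -> primitive I w -> size w <= n.+1 ^ instance_count.+1.
Proof.
move=> bI wI; have [m1 m2 b1 b2] := bI.
have [z [zI -> _ _ _]] := primitive_successor m1 m2 wI.
have bI' := bounded_successor bI.
pose J k := iter k (@successor A A) (successor I).
have bJ k : bounded_pair (J k) by elim: k => //= k; apply: bounded_successor.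
have [i [j [lt_ij le_j eqJ]]] := repeated_instance bJ.
have [y [yJ hy szy _ _]] := iterated_successor i bI' zI.
have [x [xJ hx _ _ eq_xy]] := iterated_successor (j - i) (bJ i) yJ.
have xy : x = y.
  have [m1' m2' _ _] := bJ i; apply: (primitive_uniq m1' m2' _ yJ hx).
  by move: xJ; rewrite -/(J i) /J -iterD subnK ?(ltnW lt_ij) // -/(J j) -eqJ.
have y1 : size y = 1 by apply: eq_xy; rewrite ?subn_gt0 ?xy.
have [_ _ b1' _] := bI'; apply: leq_trans (size_extend_bound _ b1') _.
rewrite expnS leq_mul2l /=; rewrite y1 muln1 in szy.
by apply: leq_trans szy _; rewrite leq_pexp2l // (leq_trans (ltnW lt_ij)).
Qed.

End Iteration.

(** * The two algorithms *)

(** The programs see a letter as a pair of a number and a sign, and an instance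
    as the two cardinals and the two lists of images of positive letters. *)
Notation raw_word := (seq (nat * bool)).
Notation raw_instance := (nat * (nat * (seq raw_word * seq raw_word)))%type.

Definition raw_letters (n : nat) : seq (nat * bool) :=
  flatten [seq [:: (j, false); (j, true)] | j <- iota 0 n].

Definition raw_image (ws : seq raw_word) (x : nat * bool) : raw_word :=
  if x.2 then winv (nth [::] ws x.1) else nth [::] ws x.1.

Definition raw_solves (i : raw_instance) (w : raw_word) : bool :=
  extend (raw_image i.2.2.1) w == extend (raw_image i.2.2.2) w.

Definition ball (T : Type) (s : seq T) (k : nat) : seq (seq T) :=
  iter k (fun ws => [::] :: flatten [seq [seq x :: w | w <- ws] | x <- s])
       [:: [::]].

(** This is [primitive_size] with n the total length of all images of letters,
    which is at least the number of their proper suffixes. *)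
Definition raw_bound (i : raw_instance) : nat :=
  let s := raw_letters i.1 in
  let n := size (extend (raw_image i.2.2.1) s ++ extend (raw_image i.2.2.2) s) in
  n.+1 ^ ((size s).+1 ^ (size s * n.+1 * 2)).+1.

Definition raw_states (i : raw_instance) : seq raw_word :=
  [seq w <- ball (raw_letters i.1) (raw_bound i) | reduce w == w].

Definition raw_solutions (i : raw_instance) : seq raw_word :=
  [seq w <- raw_states i | ~~ nilp w && raw_solves i w].

(** The factors of a reduced word are reduced and no longer than it, so a
    factorisation into solutions takes place within [raw_solutions]. *)
Definition raw_primitives (i : raw_instance) : seq raw_word :=
  [seq w <- raw_solutions i |
    ~~ has (eq_op w)
         (flatten [seq [seq u ++ v | v <- raw_solutions i] | u <- raw_solutions i])].

Definition up_to_inverse (A : eqType) (ws : seq (seq (letter A))) :=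
  foldr (fun w vs => if has (eq_op w) vs || has (eq_op (winv w)) vs then vs
                     else w :: vs) [::] ws.

Definition raw_basis (i : raw_instance) : seq raw_word :=
  up_to_inverse (raw_primitives i).

(** A state is the part of the input that follows the longest proper prefix that
    is a solution.  A complete solution is kept in the state until the next
    letter arrives, since its last letter tells which letter would cancel.  A
    word which is not among the states, unreduced or too long, is the sink. *)
Definition raw_step (i : raw_instance) (w : raw_word) (x : nat * bool) : raw_word :=
  if raw_solves i w && (reduce (w ++ [:: x]) == w ++ [:: x]) then [:: x]
  else w ++ [:: x].

(** Any unreduced word would do: none of its extensions is a state, and it is
    rejecting. *)
Definition raw_sink : raw_word := [:: (0, false); (0, true)].

(** The index of a word that is not a state is the number of states, which is
    the number of the sink in the transition table. *)
Definition raw_dfa (i : raw_instance) :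
    nat * seq (bool * seq (nat * nat)) :=
  (index [::] (raw_states i),
   [seq ((reduce w == w) && raw_solves i w,
         [seq (index (raw_step i w (a, false)) (raw_states i),
               index (raw_step i w (a, true)) (raw_states i))
         | a <- iota 0 i.1])
   | w <- raw_states i ++ [:: raw_sink]]).

Lemma computable_raw_letters : computable raw_letters.
Proof. by rewrite /raw_letters; computability. Qed.

Lemma computable_linv : computable (@linv nat : nat * bool -> nat * bool).
Proof. by rewrite /linv; computability. Qed.
#[export] Hint Extern 0 (computable raw_letters) =>
  exact computable_raw_letters : computable_db.
#[export] Hint Extern 0 (computable (@linv _)) =>
  exact computable_linv : computable_db.

Lemma computable_reduce : computable (@reduce nat : raw_word -> raw_word).
Proof.
have c : computable (fun z : (nat * bool) * raw_word => @lcons nat z.1 z.2).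
  apply: (eq_computable (f := fun z : (nat * bool) * raw_word =>
    if nilp z.2 then [:: z.1]
    else if head z.1 z.2 == linv z.1 then behead z.2 else z.1 :: z.2)).
    by case=> x [|y w].
  by computability.
by rewrite /reduce; computability.
Qed.

Lemma computable_winv : computable (@winv nat : raw_word -> raw_word).
Proof. by rewrite /winv; computability. Qed.
#[export] Hint Extern 0 (computable (@reduce _)) =>
  exact computable_reduce : computable_db.
#[export] Hint Extern 0 (computable (@winv _)) =>
  exact computable_winv : computable_db.

Lemma computable_raw_image :
  computable (fun z : seq raw_word * (nat * bool) => raw_image z.1 z.2).
Proof. by rewrite /raw_image; computability. Qed.
#[export] Hint Extern 0 (computable (fun _ => raw_image _ _)) =>
  exact computable_raw_image : computable_db.

Lemma computable_raw_solves :
  computable (fun z : raw_instance * raw_word => raw_solves z.1 z.2).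
Proof.
by rewrite /raw_solves /extend; computability.
Qed.
#[export] Hint Extern 0 (computable (fun _ => raw_solves _ _)) =>
  exact computable_raw_solves : computable_db.

Lemma computable_raw_states : computable raw_states.
Proof.
by rewrite /raw_states /ball /raw_bound /extend; computability.
Qed.
#[export] Hint Extern 0 (computable raw_states) =>
  exact computable_raw_states : computable_db.

Lemma computable_raw_basis : computable raw_basis.
Proof.
by rewrite /raw_basis /up_to_inverse /raw_primitives /raw_solutions; computability.
Qed.

Lemma computable_raw_dfa : computable raw_dfa.
Proof.
have c : computable (fun z : raw_word * seq raw_word => index z.1 z.2).
  apply: (eq_computable (f := fun z : raw_word * seq raw_word =>
    foldr (fun w n => if w == z.1 then 0 else n.+1) 0 z.2)).
    by case=> w; elim=> //= v s ->; case: eqP.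
  by computability.
by rewrite /raw_dfa /raw_step; computability.
Qed.

(** * Immersions as marked maps *)

Section Words.
Variable A : eqType.
Implicit Types (x y : letter A) (u v w : seq (letter A)).

Lemma reduced_cons2 x y w : reduced (x :: y :: w) = (y != linv x) && reduced (y :: w).
Proof. by []. Qed.

Lemma reduced_cat u v : reduced (u ++ v) -> reduced u /\ reduced v.
Proof.
move=> r; split; first by case: u r => // x u; rewrite /reduced /= cat_path => /andP[].
by elim: u r => // x u IHu /reduced_behead.
Qed.

Lemma winvK : involutive (@winv A).
Proof. by move=> w; rewrite /winv map_rev revK mapK //; apply: linvK. Qed.

Lemma winv_cat u v : winv (u ++ v) = winv v ++ winv u.
Proof. by rewrite /winv map_cat rev_cat. Qed.

Lemma winv_eq0 w : (winv w == [::]) = (w == [::]).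
Proof. by rewrite -!size_eq0 size_rev size_map. Qed.

Lemma linv_neq x : linv x != x.
Proof. by case: x => a []; rewrite /linv /= xpair_eqE andbF. Qed.

(** A freely reduced word that is its own inverse would have, in its middle,
    a letter equal to its inverse or two cancelling letters. *)
Lemma winv_neq w : reduced w -> w != [::] -> winv w != w.
Proof.
have [n] := ubnP (size w); elim: n w => // n IHn [|x w] // szw rw _.
apply/eqP; rewrite /winv /= rev_cons.
case/lastP: w szw rw => [|w y] szw rw; first by move=> [/eqP];
  rewrite (negPf (linv_neq x)).
rewrite map_rcons rev_rcons /= => -[yx /(congr1 rev)].
rewrite !rev_rcons => -[_ /(congr1 rev)]; rewrite !revK => wE.
have /reduced_cat[rw' _] : reduced (w ++ [:: y]).
  by rewrite cats1; apply: reduced_behead rw.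
case: w => [|z w] in szw rw rw' wE *.
  by move: rw; rewrite reduced_cons2 -yx linvK eqxx.
have /eqP[] : winv (z :: w) != z :: w.
  by apply: IHn => //; move: szw; rewrite /= size_rcons /=; lia.
exact: wE.
Qed.
End Words.

Section Immersions.
Local Open Scope group_scope.
Variables (A B : choiceType) (f : {multiplicative freeGroup A -> freeGroup B}).
Hypothesis f_imm : immersion f.

Definition letter_image (x : letter A) : seq (letter B) := word (f (of_letter x)).

Lemma morph1 : f 1 = 1.
Proof. by apply: (mulgI (f 1)); rewrite -gmulfM !mulg1. Qed.

Lemma morphV x : f x^-1 = (f x)^-1.
Proof. by apply/esym/mulg1_eq; rewrite -gmulfM mulgV morph1. Qed.

Lemma letter_image_inv x : letter_image (linv x) = winv (letter_image x).
Proof.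
rewrite /letter_image -[RHS]/(word (f (of_letter x))^-1) -morphV.
by congr (word (f _)); apply: val_inj.
Qed.

Lemma letter_image_neq0 x : letter_image x != [::].
Proof. by case: f_imm => /(_ x)/eqP. Qed.

Lemma letter_image_marked : marked letter_image.
Proof.
move=> x y _ E; apply/eqP; apply/negP => /negP/eqP xy.
by case: f_imm => _ /(_ x y xy) /(_ E).
Qed.

Lemma defined_image w : defined letter_image w.
Proof. by apply/allP => x _; apply: letter_image_neq0. Qed.

(** Images of consecutive letters of a reduced word do not cancel: the image
    of y and the image of the inverse of x start differently. *)
Lemma reduced_extend w : reduced w -> reduced (extend letter_image w).
Proof.
elim: w => // x w IHw rw; rewrite extend_cons.
have rw' := IHw (reduced_behead rw).
have rx : reduced (letter_image x) := word_reduced _.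
case: w rw {IHw} rw' => [|y w]; first by rewrite cats0.
rewrite reduced_cons2 extend_cons => /andP[yx _] rw'.
have hd : ohead (letter_image y) <> ohead (winv (letter_image x)).
  move=> E; case/eqP: yx; apply: letter_image_marked (letter_image_neq0 y) _.
  by rewrite E letter_image_inv.
case/lastP: (letter_image x) rx (letter_image_neq0 x) hd => // s a rx _.
case: (letter_image y) (letter_image_neq0 y) rw' => // b t _ rw' hd.
have ba : b != linv a.
  by apply/eqP => ba; apply: hd; rewrite /winv map_rcons rev_rcons /= ba.
case: s {hd} rx => [|c s] rx; first by rewrite /reduced /= ba.
rewrite /= /reduced /= cat_path last_rcons; apply/andP; split; first exact: rx.
by rewrite /= ba.
Qed.

Lemma free_group_cons x w (rxw : reduced (x :: w)) :
  @FreeGroup A _ rxw = of_letter x * @FreeGroup A _ (reduced_behead rxw).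
Proof. by apply: val_inj; rewrite /= -[RHS]/(reduce (x :: w)) reduce_id. Qed.

Lemma word_image x : word (f x) = extend letter_image (word x).
Proof.
case: x => w rw /=; elim: w rw => [|x w IHw] rw.
  rewrite (_ : @FreeGroup A _ rw = 1) ?morph1 //; exact: val_inj.
rewrite free_group_cons gmulfM -[LHS]/(reduce (letter_image x ++ _)) IHw -extend_cons.
by rewrite reduce_id //; apply: reduced_extend.
Qed.

Lemma extend_winv w : extend letter_image (winv w) = winv (extend letter_image w).
Proof.
elim: w => // x w IHw; rewrite -cat1s winv_cat !extend_cat winv_cat IHw /extend /=.
by rewrite !cats0 letter_image_inv.
Qed.

Lemma immersion_inj : injective f.
Proof.
move=> x y E; apply/eqP; rewrite -divg_eq1; apply/eqP/val_inj => /=.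
have := word_image (x * y^-1); rewrite gmulfM morphV E mulgV /=.
case: (reduce _) => // z w; rewrite extend_cons.
by case: (letter_image z) (letter_image_neq0 z).
Qed.

End Immersions.

Section Equaliser.
Local Open Scope group_scope.
Variables (A B : choiceType) (g h : {multiplicative freeGroup A -> freeGroup B}).
Hypotheses (g_imm : immersion g) (h_imm : immersion h).

Definition image_pair := (letter_image g, letter_image h).

Lemma solutionE w :
  solution image_pair w = (extend (letter_image g) w == extend (letter_image h) w).
Proof. by rewrite /solution !defined_image. Qed.

Lemma mem_equaliser x : (x \in equaliser g h) = solution image_pair (word x).
Proof.
by rewrite solutionE -!word_image // (inj_eq val_inj).
Qed.

Lemma solution_winv w : solution image_pair (winv w) = solution image_pair w.
Proof. by rewrite !solutionE !extend_winv (inj_eq (inv_inj (@winvK B))). Qed.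

Lemma primitive_winv w : primitive image_pair w -> primitive image_pair (winv w).
Proof.
case=> sw w0 wP; split; rewrite ?solution_winv ?winv_eq0 // => u v wE su.
have {}wE : w = winv v ++ winv u by rewrite -winv_cat -wE winvK.
have sv : solution image_pair (winv v).
  move: sw; rewrite -solution_winv wE winv_cat !winvK solution_catl //.
  by rewrite solution_winv.
by have [/eqP|/eqP] := wP _ _ wE sv; rewrite winv_eq0 => /eqP; [right|left].
Qed.

Lemma primitive_head u v : primitive image_pair u -> primitive image_pair v ->
  ohead u = ohead v -> u = v.
Proof. by apply: primitive_uniq; apply: letter_image_marked. Qed.

(** The morphism from the free group on the positions of [ws] is itself an
    immersion: the words of the members of [ws] and of their inverses are
    primitive solutions, and these are told apart by their first letters.  So it
    is injective; it is onto because every solution is a product of primitive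
    ones. *)
Lemma primitives_basis (ws : seq (freeGroup A)) :
  uniq ws ->
  (forall x, x \in ws -> primitive image_pair (word x)) ->
  (forall x, primitive image_pair (word x) -> (x \in ws) || (x^-1 \in ws)) ->
  (forall x, x \in ws -> x^-1 \notin ws) ->
  is_basis ws (equaliser g h).
Proof.
move=> uws wsP wsC wsV; set b := tnth (in_tuple ws).
have bE l : lift_fun b (of_letter l) = letter_val b l by rewrite /lift_fun big_seq1.
have bP l : primitive image_pair (word (letter_val b l)).
  case: l => i [] /=; rewrite /letter_val /=; last by apply: wsP; apply: mem_tnth.
  by apply: primitive_winv; apply: wsP; apply: mem_tnth.
have b_imm : immersion (lift_fun b).
  split=> [l|l l' ll']; rewrite ?bE; first by case: (bP l) => _ /eqP.
  move=> /(primitive_head (bP l) (bP l'))/val_inj E; apply: ll'.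
  have injb : injective b by apply/tuple_uniqP.
  have bV i j : b i <> (b j)^-1.
    by move=> bij; case/negP: (wsV _ (mem_tnth j (in_tuple ws)));
       rewrite -[_^-1]bij; apply: mem_tnth.
  case: l l' E => [i []] [j []]; rewrite /letter_val /=.
  - by move=> /invg_inj/injb->.
  - by move=> /esym/bV.
  - by move=> /bV.
  - by move=> /injb->.
split; first exact: immersion_inj b_imm.
move=> x; split=> [|[y <-]].
  rewrite mem_equaliser; have [n] := ubnP (size (word x)).
  elim: n x => // n IHn x szx sx.
  have [x1|x0] := eqVneq (word x) [::].
    exists 1; rewrite (_ : x = 1); last exact: val_inj.
    by apply: val_inj; rewrite /= /lift_fun big_nil.
  have [p [r [xE pP]]] := primitive_prefix sx x0.
  have [rp rr] : reduced p /\ reduced r by apply: reduced_cat; rewrite -xE word_reduced.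
  pose xp := @FreeGroup A _ rp; pose xr := @FreeGroup A _ rr.
  have {xE}[xM xE] : x = xp * xr /\ word x = p ++ r.
    by split=> //; apply: val_inj; rewrite /= -xE reduce_id // word_reduced.
  have [sp p0 _] := pP.
  have [||y yE] := IHn xr.
    rewrite -ltnS; apply: leq_trans szx; rewrite ltnS xE size_cat.
    by rewrite -[X in X < _]add0n ltn_add2r -size_neq0.
    by move: sx; rewrite xE solution_catl.
  have [l lE] : exists l, letter_val b l = xp.
    have /orP[/(tnthP (in_tuple ws))[i iE]|/(tnthP (in_tuple ws))[i iE]] := wsC xp pP.
      by exists (i, false).
    by exists (i, true); rewrite /letter_val /= -[b i]iE invgK.
  by exists (of_letter l * y); rewrite lift_funM bE lE yE.
rewrite mem_equaliser (word_image b_imm); elim: (word y) => // l w IHw.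
have imE : letter_image (lift_fun b) l = word (letter_val b l) by rewrite -bE.
by rewrite extend_cons imE solution_catl //; case: (bP l).
Qed.

End Equaliser.

(** * Correctness of the algorithms *)

Lemma mem_ball (T : eqType) (s : seq T) k w :
  (w \in ball s k) = (size w <= k) && all [in s] w.
Proof.
elim: k w => [|k IHk] [|x w] //=; rewrite in_cons /=; apply/flatten_mapP/idP.
  move=> [y ys /mapP[v]]; rewrite -/(ball s k) IHk => /andP[szv vs] [-> ->].
  by rewrite ltnS szv ys.
rewrite ltnS => /and3P[szw xs ws]; exists x => //; apply: map_f.
by rewrite -/(ball s k) IHk szw.
Qed.

Lemma mem_up_to_inverse (A : eqType) (ws : seq (seq (letter A))) :
  {subset up_to_inverse ws <= ws}.
Proof.
elim: ws => //= w ws IHws v; case: ifP => _; rewrite ?in_cons.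
  by move/IHws->; rewrite orbT.
by case/orP=> [->//|/IHws->]; rewrite orbT.
Qed.

Lemma has_eq_op (T : eqType) (x : T) s : has (eq_op x) s = (x \in s).
Proof. by rewrite -has_pred1; apply: eq_has => y; rewrite /= eq_sym. Qed.

Lemma up_to_inverse_complete (A : eqType) (ws : seq (seq (letter A))) w :
  w \in ws -> (w \in up_to_inverse ws) || (winv w \in up_to_inverse ws).
Proof.
elim: ws => //= v ws IHws; rewrite !has_eq_op in_cons.
case: ifP => [vw /predU1P[->|/IHws]//|_ /predU1P[->|/IHws/orP[]]].
- by rewrite mem_head.
- by rewrite !in_cons => ->; rewrite orbT.
- by rewrite !in_cons => ->; rewrite !orbT.
Qed.

Lemma up_to_inverse_uniq (A : eqType) (ws : seq (seq (letter A))) :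
  uniq (up_to_inverse ws).
Proof.
by elim: ws => //= v ws IHws; rewrite !has_eq_op; case: ifPn => //= /norP[-> _].
Qed.

Lemma up_to_inverse_winv (A : eqType) (ws : seq (seq (letter A))) w :
  w \in up_to_inverse ws -> winv w \in up_to_inverse ws -> winv w = w.
Proof.
elim: ws => //= v ws IHws; rewrite !has_eq_op; case: ifPn => // /norP[_ vV].
rewrite !in_cons => /predU1P[->|wB] /predU1P[//|]; first by rewrite (negPf vV).
  by move=> wv; move: vV; rewrite -wv winvK wB.
exact: IHws.
Qed.

Section Code.
Variable A : finType.

Definition code (x : letter A) : nat * bool := (enum_rank x.1 : nat, x.2).

Lemma code_inj : injective code.
Proof. by case=> a b [a' b'] [/val_inj/enum_rank_inj-> ->]. Qed.

Lemma code_linv x : linv (code x) = code (linv x).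
Proof. by []. Qed.

Lemma reduced_code w : reduced (map code w) = reduced w.
Proof.
rewrite /reduced sorted_map; apply: eq_sorted => x y /=.
by rewrite code_linv (inj_eq code_inj).
Qed.

Lemma reduceE (B : eqType) (w : seq (letter B)) : (reduce w == w) = reduced w.
Proof.
by apply/eqP/idP => [<-|/reduce_id //]; apply: reduced_reduce.
Qed.

Lemma winv_code w : winv (map code w) = map code (winv w).
Proof. by rewrite /winv map_rev -!map_comp. Qed.

Lemma map_enum_rank : [seq (enum_rank a : nat) | a <- enum A] = iota 0 #|A|.
Proof.
apply: (@eq_from_nth _ 0); first by rewrite size_map size_iota cardE.
move=> i; rewrite size_map -cardE => lt_i.
have [a aE] : exists a, enum_rank a = Ordinal lt_i.
  by exists (enum_val (Ordinal lt_i)); rewrite enum_valK.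
rewrite nth_iota // (nth_map a) -?cardE // -[nth a _ i]/(nth a (enum A) (Ordinal lt_i)).
by rewrite -aE nth_enum_rank aE.
Qed.

Definition letters : seq (letter A) :=
  flatten [seq [:: (a, false); (a, true)] | a <- enum A].

Lemma raw_letters_code : raw_letters #|A| = map code letters.
Proof.
rewrite /raw_letters /letters -map_enum_rank map_flatten -!map_comp.
by congr flatten; apply: eq_map.
Qed.

Lemma mem_letters x : x \in letters.
Proof.
apply/flatten_mapP; exists x.1; first by rewrite mem_enum.
by case: x => a []; rewrite !inE eqxx ?orbT.
Qed.

Lemma size_letters : size letters = #|{: letter A}|.
Proof.
rewrite /letters card_prod card_bool cardE size_flatten /shape -map_comp.
by elim: (enum A) => //= a s ->; lia.
Qed.

Lemma raw_letters_word w : all [in raw_letters #|A|] w -> exists v, w = map code v.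
Proof.
rewrite raw_letters_code; elim: w => [|x w IHw]; first by exists [::].
by case/andP=> /mapP[y _ ->] /IHw[v ->]; exists (y :: v).
Qed.

End Code.

Lemma enc_list_map (T : Type) (U : Type) {eU : encoding U} (f : T -> U) s :
  enc_list (fun x => enc (f x)) s = enc (map f s).
Proof. by elim: s => //= x s ->. Qed.

Section Instance.
Variables (Sigma Delta : finType).
Variables (g h : {multiplicative freeGroup Sigma -> freeGroup Delta}).
Hypotheses (g_imm : immersion g) (h_imm : immersion h).

Definition raw_morphism (f : freeGroup Sigma -> freeGroup Delta) : seq raw_word :=
  [seq map (@code Delta) (word (f (of_letter (a, false)))) | a <- enum Sigma].

Definition raw_of : raw_instance :=
  (#|Sigma|, (#|Delta|, (raw_morphism g, raw_morphism h))).

Lemma enc_element_code (A : finType) (x : freeGroup A) :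
  enc_element x = enc (map (@code A) (word x)).
Proof. exact: enc_list_map. Qed.

Lemma enc_raw_of : enc_instance g h = enc raw_of.
Proof.
have E f : enc_morphism f = enc (raw_morphism f).
  rewrite -enc_list_map /enc_morphism; elim: (enum Sigma) => //= a s ->.
  by rewrite enc_element_code.
by rewrite /enc_instance !E.
Qed.

Lemma raw_image_code (f : {multiplicative freeGroup Sigma -> freeGroup Delta}) x :
  raw_image (raw_morphism f) (code x) = map (@code Delta) (letter_image f x).
Proof.
have E a : nth [::] (raw_morphism f) (enum_rank a) =
    map (@code Delta) (letter_image f (a, false)).
  rewrite (nth_map a) ?nth_enum_rank // -cardE; exact: ltn_ord.
case: x => a []; rewrite /raw_image /= E // winv_code -letter_image_inv //.
Qed.

Lemma extend_code (f : {multiplicative freeGroup Sigma -> freeGroup Delta}) w :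
  extend (raw_image (raw_morphism f)) (map (@code Sigma) w) =
  map (@code Delta) (extend (letter_image f) w).
Proof. by elim: w => // x w IHw; rewrite /= !extend_cons map_cat raw_image_code IHw. Qed.

Local Notation I := (image_pair g h).
Local Notation cw := (map (@code Sigma)).

Lemma raw_solves_code w : raw_solves raw_of (cw w) = solution I w.
Proof.
by rewrite /raw_solves !extend_code solutionE // (inj_eq (inj_map (@code_inj _))).
Qed.

Lemma primitive_raw_bound w : primitive I w -> size w <= raw_bound raw_of.
Proof.
set n := size (extend (letter_image g) (letters Sigma) ++
               extend (letter_image h) (letters Sigma)).
have -> : raw_bound raw_of = n.+1 ^ (instance_count (letter Sigma) n).+1.
  rewrite /raw_bound /= raw_letters_code !extend_code -map_cat !size_map size_letters.
  by [].
apply: primitive_size; split; rewrite /=; try exact: letter_image_marked.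
- by apply: (extend_suffix_bound (@mem_letters Sigma)); rewrite /n size_cat leq_addr.
- by apply: (extend_suffix_bound (@mem_letters Sigma)); rewrite /n size_cat leq_addl.
Qed.

Lemma raw_statesP w : reflect
  (exists v, [/\ w = cw v, reduced v & size v <= raw_bound raw_of])
  (w \in raw_states raw_of).
Proof.
rewrite mem_filter reduceE mem_ball; apply: (iffP and3P) => [[rw szw]|[v [-> rv szv]]].
  move=> /raw_letters_word[v wE]; exists v.
  by rewrite -reduced_code -(size_map (@code Sigma)) -wE.
rewrite reduced_code size_map; split=> //; rewrite raw_letters_code all_map.
by apply/allP => x _ /=; rewrite map_f ?mem_letters.
Qed.

Lemma raw_solutionsP w : reflect
  (exists v, [/\ w = cw v, reduced v, size v <= raw_bound raw_of, v != [::] &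
    solution I v])
  (w \in raw_solutions raw_of).
Proof.
rewrite mem_filter /nilp size_eq0; apply: (iffP andP).
  move=> [/andP[w0 sw] /raw_statesP[v [wE rv szv]]]; exists v; split=> //.
    by move: w0; rewrite wE; case: (v).
  by rewrite -raw_solves_code -wE.
move=> [v [-> rv szv v0 sv]]; rewrite raw_solves_code sv.
by split; [case: (v) v0 | apply/raw_statesP; exists v].
Qed.

Lemma raw_primitivesP w : reflect
  (exists v, [/\ w = cw v, reduced v & primitive I v]) (w \in raw_primitives raw_of).
Proof.
rewrite mem_filter has_eq_op; apply: (iffP andP).
  move=> [/flatten_mapP nprod /raw_solutionsP[v [wE rv szv v0 sv]]].
  exists v; split=> //; split=> // u t vE su.
  have [|u0] := eqVneq u [::]; first by left.
  have [|t0] := eqVneq t [::]; first by right.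
  have st : solution I t by rewrite -(solution_catl _ su) -vE.
  have [ru rt] : reduced u /\ reduced t by apply: reduced_cat; rewrite -vE.
  move: szv; rewrite vE size_cat => szv.
  case: nprod; exists (cw u).
    by apply/raw_solutionsP; exists u; split=> //; lia.
  apply/mapP; exists (cw t); last by rewrite wE vE map_cat.
  by apply/raw_solutionsP; exists t; split=> //; lia.
move=> [v [-> rv pv]]; have [sv v0 vP] := pv; split; last first.
  by apply/raw_solutionsP; exists v; split=> //; apply: primitive_raw_bound.
apply/flatten_mapP => -[_ /raw_solutionsP[u [-> _ _ u0 su]]].
move=> /mapP[_ /raw_solutionsP[t [-> _ _ t0 _]]].
rewrite -map_cat => /(inj_map (@code_inj _)) vE.
by have [E|E] := vP _ _ vE su; [rewrite E in u0 | rewrite E in t0].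
Qed.

Lemma raw_basis_correct : exists2 ws : seq (freeGroup Sigma),
  is_basis ws (equaliser g h) & raw_basis raw_of = [seq cw (word x) | x <- ws].
Proof.
have [ws wsE] : exists ws : seq (freeGroup Sigma),
    raw_basis raw_of = [seq cw (word x) | x <- ws].
  have: all [in raw_primitives raw_of] (raw_basis raw_of).
    by apply/allP => w; apply: mem_up_to_inverse.
  elim: (raw_basis _) => [|w s IHs]; first by exists [::].
  move=> /andP[/raw_primitivesP[v [-> rv _]] /IHs[ws ->]].
  by exists (@FreeGroup Sigma _ rv :: ws).
exists ws => //.
have cw_inj : injective (fun x : freeGroup Sigma => cw (word x)).
  by move=> x y /(inj_map (@code_inj _))/val_inj.
have memE x : (cw (word x) \in raw_basis raw_of) = (x \in ws).
  by rewrite wsE (mem_map cw_inj).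
have memV x : (winv (cw (word x)) \in raw_basis raw_of) = (fg_inv x \in ws).
  by rewrite winv_code -memE.
have wsP x : x \in ws -> primitive I (word x).
  rewrite -memE => /mem_up_to_inverse/raw_primitivesP[v [xE _ pv]].
  by have -> : word x = v by apply: (inj_map (@code_inj _)).
apply: primitives_basis => //.
- by rewrite -(map_inj_uniq cw_inj) -wsE; apply: up_to_inverse_uniq.
- move=> x px; rewrite -memE -[_^-1%g]/(fg_inv x) -memV.
  apply: up_to_inverse_complete; apply/raw_primitivesP.
  by exists (word x); split=> //; apply: word_reduced.
- move=> x xws; apply/negP; rewrite -[_^-1%g]/(fg_inv x) -memV => xV.
  have [_ x0 _] := wsP x xws.
  have /eqP[] := winv_neq (word_reduced x) x0.
  apply: (inj_map (@code_inj Sigma)); rewrite -winv_code.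
  by apply: up_to_inverse_winv xV; rewrite memE.
Qed.

Local Notation Q := (raw_states raw_of).
Local Notation state_word := (nth raw_sink Q).

Definition equaliser_dfa : dfa (letter Sigma) :=
  @DFA _ (size Q).+1 (inord (index [::] Q))
    (fun q => (reduce (state_word q) == state_word q) &&
              raw_solves raw_of (state_word q))
    (fun q x => inord (index (raw_step raw_of (state_word q) (code x)) Q)).

Lemma inord_index w : (inord (index w Q) : 'I_(size Q).+1) = index w Q :> nat.
Proof. by rewrite inordK // ltnS index_size. Qed.

Lemma enc_equaliser_dfa : enc_dfa equaliser_dfa = enc (raw_dfa raw_of).
Proof.
pose F w := ((reduce w == w) && raw_solves raw_of w,
  [seq (index (raw_step raw_of w (a, false)) Q,
        index (raw_step raw_of w (a, true)) Q) | a <- iota 0 #|Sigma|]).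
rewrite /enc_dfa /raw_dfa -/Q -[X in _ = enc (_, X)]/[seq F w | w <- _].
congr Node; first by rewrite inord_index.
have -> : Q ++ [:: raw_sink] = [seq state_word (val q) | q <- enum 'I_(size Q).+1].
  rewrite (map_comp state_word val) val_enum_ord -addn1 iotaD map_cat.
  by rewrite -[map _ _]/(mkseq state_word (size Q)) mkseq_nth /= nth_default.
rewrite -map_comp -enc_list_map.
elim: (enum 'I_(size Q).+1) => //= q qs ->; congr (Node (Node _ _) _).
rewrite [(F _).2]/= -map_enum_rank -map_comp -enc_list_map.
by elim: (enum Sigma) => //= a s ->; rewrite !inord_index.
Qed.

Definition irreducible (r : seq (letter Sigma)) :=
  forall u t, r = u ++ t -> solution I u -> u = [::] \/ t = [::].

(** What state k remembers of the input w: the part r that follows the longest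
    proper prefix v of w in the equaliser.  In the sink, no continuation of w
    lies in the equaliser. *)
Variant reaches (w : seq (letter Sigma)) (k : nat) : Prop :=
| ReachesState v r of w = v ++ r & reduced w & k = index (cw r) Q
    & size r <= raw_bound raw_of & solution I v & irreducible r
    & (r = [::] -> w = [::])
| ReachesSink of k = size Q & forall t, reduced (w ++ t) -> ~~ solution I (w ++ t).

Lemma state_word_index r : reduced r -> size r <= raw_bound raw_of ->
  state_word (index (cw r) Q) = cw r.
Proof. by move=> rr szr; apply: nth_index; apply/raw_statesP; exists r. Qed.

Lemma index_unreduced w : ~~ reduced w -> index w Q = size Q.
Proof.
move=> nr; apply/eqP; rewrite eqn_leq index_size leqNgt index_mem.
by apply: contra nr => /raw_statesP[v [-> rv _]]; rewrite reduced_code.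
Qed.

(** The sink is entered for one of two reasons: the new letter cancels, or r has
    become longer than any primitive solution and so cannot be completed. *)
Lemma reaches_step w k x : reaches w k ->
  reaches (rcons w x) (index (raw_step raw_of (state_word k) (code x)) Q).
Proof.
case=> [v r wE rw -> szr sv ir rnil|-> dead]; last first.
  constructor 2 => [|t]; last by rewrite cat_rcons; apply: dead.
  rewrite nth_default // index_unreduced //.
  by rewrite /raw_step reduceE andbF.
have [_ rr] : reduced v /\ reduced r by apply: reduced_cat; rewrite -wE.
rewrite state_word_index // /raw_step raw_solves_code reduceE cats1 -map_rcons.
rewrite reduced_code.
have red_r : reduced (rcons w x) = reduced (rcons r x).
  case: r wE {szr ir rr} rnil => [|y r] wE rnil; first by rewrite rnil.
  case: v wE {sv} => [->//|z v] wE; move: rw.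
  rewrite wE /reduced /= !rcons_path !cat_path /= => /and3P[-> -> ->].
  by rewrite last_cat.
have [rwx|nrwx] := boolP (reduced (rcons w x)); last first.
  constructor 2 => [|t]; last first.
    by move=> /reduced_cat[]; rewrite (negPf nrwx).
  by rewrite -red_r (negPf nrwx) andbF index_unreduced // reduced_code -red_r.
rewrite -red_r rwx andbT; case: ifPn => [sr|nsr].
  apply: (@ReachesState _ _ w [:: x]) => //; rewrite ?cats1 //.
  - by rewrite /raw_bound expn_gt0.
  - by rewrite wE solution_catl.
  - move=> [|y u] t tE _; first by left.
    by right; case: t u tE => [|? ?] [|? ?].
have irx : irreducible (rcons r x).
  move=> u t; case/lastP: t => [|t y]; first by right.
  rewrite -rcons_cat => /rcons_inj[rE _] su; left.
  by have [//|t0] := ir u t rE su; move: nsr; rewrite rE t0 cats0 su.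
have [szrx|szrx] := leqP (size (rcons r x)) (raw_bound raw_of).
  apply: (@ReachesState _ _ v (rcons r x)) => //; first by rewrite wE rcons_cat.
  by case: (r).
constructor 2.
  apply/eqP; rewrite eqn_leq index_size leqNgt index_mem.
  apply/negP => /raw_statesP[u [/(inj_map (@code_inj _)) <- _]].
  by rewrite leqNgt szrx.
move=> t _; apply/negP; rewrite wE rcons_cat -catA solution_catl // => st.
have [|p [t' [pE pP]]] := primitive_prefix st; first by case: (r).
have szp := primitive_raw_bound pP; have [sp p0 _] := pP.
have rE : rcons r x = p ++ drop (size p) (rcons r x).
  rewrite -{1}[rcons r x](cat_take_drop (size p)); congr (_ ++ _).
  have := congr1 (take (size p)) pE.
  by rewrite (take_size_cat t' (erefl _)) take_cat (leq_ltn_trans szp szrx).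
have [p00|/(congr1 size)] := irx _ _ rE sp; first by rewrite p00 in p0.
by rewrite size_drop => /eqP; rewrite subn_eq0 leqNgt (leq_ltn_trans szp szrx).
Qed.

Lemma reaches_dfa w :
  reaches w (foldl (@dfa_step _ equaliser_dfa) (dfa_init equaliser_dfa) w).
Proof.
elim/last_ind: w => [|w x IHw] /=.
  rewrite inord_index; apply: (@ReachesState _ _ [::] [::]) => //.
  by move=> [|? ?] [|? ?] //; left.
by rewrite foldl_rcons /= inord_index; apply: reaches_step.
Qed.

Lemma equaliser_dfa_correct : recognises equaliser_dfa (words_of (equaliser g h)).
Proof.
move=> w; have wordsE : words_of (equaliser g h) w <-> reduced w /\ solution I w.
  split=> [[x] + <-|[rw sw]]; first by rewrite mem_equaliser // word_reduced.
  by exists (@FreeGroup Sigma _ rw) => //; rewrite mem_equaliser.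
rewrite wordsE /dfa_accepts /=.
case: (reaches_dfa w) => [v r wE rw -> szr sv _ _|-> dead]; last first.
  rewrite nth_default // reduceE /=; split=> // -[rw sw].
  by have := dead [::]; rewrite cats0 sw => /(_ rw).
have [_ rr] : reduced v /\ reduced r by apply: reduced_cat; rewrite -wE.
rewrite state_word_index // reduceE reduced_code rr raw_solves_code /=.
have -> : solution I w = solution I r by rewrite wE solution_catl.
by split=> [|[]].
Qed.

End Instance.

Theorem corollary7 :
  (exists p : cmd,
     forall (Sigma Delta : finType)
            (g h : {multiplicative freeGroup Sigma -> freeGroup Delta}),
       immersion g -> immersion h ->
       exists2 B : seq (freeGroup Sigma),
         is_basis B (equaliser g h) &
         exec p (enc_instance g h) (enc_basis B))
  /\
  (exists p : cmd,
     forall (Sigma Delta : finType)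
            (g h : {multiplicative freeGroup Sigma -> freeGroup Delta}),
       immersion g -> immersion h ->
       exists2 M : dfa (letter Sigma),
         recognises M (words_of (equaliser g h)) &
         exec p (enc_instance g h) (enc_dfa M)).
Proof.
split.
  have [p pP] := computable_raw_basis.
  exists p => Sigma Delta g h g_imm h_imm.
  have [B B_basis BE] := raw_basis_correct g_imm h_imm; exists B => //.
  have -> : enc_basis B = enc (raw_basis (raw_of g h)).
    rewrite BE -enc_list_map /enc_basis.
    by elim: (B) => //= x s ->; rewrite enc_element_code.
  by rewrite enc_raw_of.
have [p pP] := computable_raw_dfa.
exists p => Sigma Delta g h g_imm h_imm.
exists (equaliser_dfa g h); first exact: equaliser_dfa_correct.
by rewrite enc_equaliser_dfa enc_raw_of.
Qed.
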